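(* Let $d\ge 1$ and let $\Omega\subset\mathbb{R}^d$ be a bounded, connected, open set with boundary of class $C^2$. Let $P\colon L^2(\Omega)\to L^2(\Omega)$ be a bounded linear operator which is monotone, i.e. $\langle P[u],u\rangle_{L^2(\Omega)}\ge 0$ for all $u\in L^2(\Omega)$. Let $U_0=(u_0,v_0)\in H^1_0(\Omega)\times L^2(\Omega)$ and let $U(t)=(u(t),v(t))=S(t)U_0$ be the unique (semigroup) solution with initial datum $U_0$ to $$\frac{\mathrm{d}U}{\mathrm{d}t}(t)+\mathscr{A}U(t)=0,\quad t\in(0,+\infty),\qquad U(0)=U_0,$$ where $\mathscr{A}(u,v)=(-v,-\Delta u+P[v])$. Then the following energy-dissipation balance holds: $$E(u(t),v(t))+\int_0^t\langle P[v(s)],v(s)\rangle_{L^2(\Omega)}\,\mathrm{d}s=E(u_0,v_0),\qquad t\in[0,+\infty),$$ where $$E(u,v)=\frac12\int_\Omega|v(x)|^2\,\mathrm{d}x+\frac12\int_\Omega|\nabla u(x)|^2\,\mathrm{d}x .$$ In particular, the energy of the solution is non-increasing in time, i.e. $$E(u(s),v(s))\ge E(u(t),v(t)),\qquad 0\le s\le t.$$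
   Context: Functions are real-valued. $H=H^1_0(\Omega)\times L^2(\Omega)$ is the Hilbert space endowed with the scalar product $\langle (u,v),(w,z)\rangle_H=\langle\nabla u,\nabla w\rangle_{L^2(\Omega)}+\langle v,z\rangle_{L^2(\Omega)}$. The operator $\mathscr{A}$ has domain $\mathrm{Dom}(\mathscr{A})=\{(u,v)\in H: u\in H^2(\Omega)\cap H^1_0(\Omega),\ v\in H^1_0(\Omega)\}$. It generates a strongly continuous semigroup of linear contractions $\{S(t)\}_{t\ge0}$ on $H$ (the infinitesimal generator in the usual sign convention is $-\mathscr{A}$) such that, for $U_0\in\mathrm{Dom}(\mathscr{A})$, $t\mapsto S(t)U_0$ belongs to $C^1([0,+\infty);H)\cap C([0,+\infty);\mathrm{Dom}(\mathscr{A}))$ and is the unique solution of the Cauchy problem $U'+\mathscr{A}U=0$, $U(0)=U_0$; for general $U_0\in H$ the solution is by definition $S(t)U_0$. The Cauchy problem is the first-order formulation of $\partial_{tt}u-\Delta u+P[\partial_t u(t,\cdot)]=0$ with homogeneous Dirichlet boundary conditions. *)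

(* Defs.v *)
From HB Require Import structures.
From mathcomp Require Import all_boot all_order all_algebra.
From mathcomp Require Import generic_quotient ring_quotient.
From mathcomp Require Import all_classical all_reals all_analysis.
From mathcomp Require Import measurable_realfun.

Set Implicit Arguments.
Unset Strict Implicit.
Unset Printing Implicit Defensive.
Import Order.TTheory GRing.Theory Num.Theory.
Import numFieldNormedType.Exports.
Local Open Scope classical_set_scope.
Local Open Scope ring_scope.

Definition matrix_borel_display : measure_display.
Proof. exact: default_measure_display. Qed.

Section borel_matrix.
Variables (R : realType) (m n : nat).

HB.instance Definition _ := @isMeasurable.Build matrix_borel_display
  'M[R]_(m, n) <<s @open 'M[R]_(m, n) >>
  (@sigma_algebra0 _ setT (@open 'M[R]_(m, n))) (@sigma_algebraC _ _)
  (@sigma_algebra_bigcup _ setT (@open 'M[R]_(m, n))).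

Lemma open_measurable_mx (O : set 'M[R]_(m, n)) : open O -> measurable O.
Proof. exact: sub_sigma_algebra. Qed.

Lemma continuous_measurable_mx (f : 'M[R]_(m, n) -> R) :
  continuous f -> measurable_fun setT f.
Proof.
move=> cf; apply: (measurability (@RGenOInfty.G R)).
  exact: RGenOInfty.measurableE.
move=> _ [_ [a ->] <-]; rewrite setTI; apply: open_measurable_mx.
by move/continuousP: cf; apply; exact: interval_open.
Qed.

End borel_matrix.

Section measurable_row.
Variables (R : realType) (n : nat).

Let qball (q : 'rV[rat]_n * nat) : set 'rV[R]_n :=
  ball (map_mx ratr q.1 : 'rV[R]_n) (q.2.+1%:R^-1).

Let open_qball (O : set 'rV[R]_n) : open O ->
  O = \bigcup_(q in [set q | qball q `<=` O]) qball q.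
Proof.
move=> oO; apply/seteqP; split => [x Ox|x [q]]; last exact.
have /nbhs_ballP[e /= e0 eO] := open_nbhs_nbhs (conj oO Ox).
have [k ke] : exists k : nat, k.+1%:R^-1 < e / 2.
  have e20 : 0 < e / 2 by rewrite divr_gt0.
  exists (Num.trunc (e / 2)^-1).
  by rewrite invf_plt ?posrE// truncnS_gt.
have kp : 0 < k.+1%:R^-1 :> R by rewrite invr_gt0.
have hq i : {q : rat | `|ratr q - x ord0 i| < k.+1%:R^-1}.
  apply: cid; have [|q] := @rat_in_itvoo R (x ord0 i) (x ord0 i + k.+1%:R^-1).
    by rewrite ltrDl.
  rewrite in_itv/= => /andP[q1 q2]; exists q.
  by rewrite gtr0_norm ?subr_gt0// ltrBlDl.
pose q := \row_i sval (hq i).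
exists (q, k); rewrite /qball/=.
  move=> y [_ qy]; apply: eO; split => // i j; rewrite ord1.
  have := qy ord0 j; rewrite !mxE /ball/= => qyj.
  rewrite -[x _ _ - _](subrKA (ratr (sval (hq j)))).
  rewrite (le_lt_trans (ler_normD _ _))// [ltRHS]splitr ltrD//.
    by rewrite distrC (lt_trans (svalP (hq j))).
  exact: lt_trans ke.
by split => // i j; rewrite ord1 !mxE; exact: (svalP (hq j)).
Qed.

Lemma measurable_row d (T : measurableType d) (f : T -> 'rV[R]_n) :
  (forall i, measurable_fun setT (fun x => f x ord0 i : R)) ->
  measurable_fun setT f.
Proof.
move=> mf; apply: (measurability (@open 'rV[R]_n)) => //.
move=> _ [A oA <-]; rewrite setTI (open_qball oA) bigcup_mkcond preimage_bigcup.
apply: countable_bigcupT_measurable; first exact: countableP.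
move=> q; case: ifPn => _; last by rewrite preimage_set0.
rewrite /qball.
set D := map_mx _ _; set e := _^-1.
have e0 : 0 < e by rewrite invr_gt0.
rewrite (_ : _ @^-1` _ =
  \bigcap_(i in setT) ((fun x => f x ord0 i) @^-1` (ball (D ord0 i) e))); last first.
  apply/seteqP; split => x /=; first by move=> [_ h] i _; exact: h.
  by move=> h; split => // i j; rewrite ord1; exact: h.
apply: fin_bigcap_measurable => // i _.
rewrite -[X in measurable X]setTI; apply: mf => //.
exact: measurable_ball.
Qed.

End measurable_row.

Section lebesgue_row.
Variable R : realType.

Definition cons_row n (x : R * 'rV[R]_n) : 'rV[R]_n.+1 :=
  row_mx (x.1%:M : 'rV[R]_1) x.2.

Definition uncons_row n (v : 'rV[R]_n.+1) : R * 'rV[R]_n :=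
  (v ord0 ord0, \row_i v ord0 (lift ord0 i)).

Fixpoint lebesgue_row n : set 'rV[R]_n -> \bar R :=
  if n is n'.+1 then pushforward (@lebesgue_measure R \x @lebesgue_row n')%E (@cons_row n')
  else \d_(0 : 'rV[R]_0).

Lemma cons_rowE0 n (x : R * 'rV[R]_n) : cons_row x ord0 ord0 = x.1.
Proof.
rewrite /cons_row (_ : ord0 = lshift n (ord0 : 'I_1)); last exact/val_inj.
by rewrite (@row_mxEl _ 1 1 n) mxE eqxx mulr1n.
Qed.

Lemma cons_rowES n (x : R * 'rV[R]_n) i : cons_row x ord0 (lift ord0 i) = x.2 ord0 i.
Proof.
rewrite /cons_row (_ : lift ord0 i = rshift 1 i); last exact/val_inj.
by rewrite (@row_mxEr _ 1 1 n).
Qed.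

Lemma cons_rowK n : cancel (@cons_row n) (@uncons_row n).
Proof.
move=> [a v]; rewrite /uncons_row cons_rowE0; congr pair.
by apply/rowP => i; rewrite mxE cons_rowES.
Qed.

Lemma measurable_cons_row n : measurable_fun setT (@cons_row n).
Proof.
apply: measurable_row => i; case: (unliftP ord0 i) => [j ->|->].
  rewrite (_ : (fun _ => _) = (fun v : 'rV[R]_n => v ord0 j) \o snd).
    apply: measurableT_comp => //.
    by apply: continuous_measurable_mx; exact: coord_continuous.
  by apply/funext => x; rewrite /= cons_rowES.
rewrite (_ : (fun _ => _) = fst)//.
by apply/funext => x; rewrite cons_rowE0.
Qed.

Lemma measurable_uncons_row n : measurable_fun setT (@uncons_row n).
Proof.
apply: measurable_fun_pair.
  by apply: continuous_measurable_mx; exact: coord_continuous.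
apply: measurable_row => i.
rewrite (_ : (fun _ => _) = (fun v : 'rV[R]_n.+1 => v ord0 (lift ord0 i))).
  by apply: continuous_measurable_mx; exact: coord_continuous.
by apply/funext => x; rewrite mxE.
Qed.

Section step.
Variables (n : nat) (m : {sigma_finite_measure set 'rV[R]_n -> \bar R}).

Definition lebesgue_row_step : set 'rV[R]_n.+1 -> \bar R :=
  pushforward (@lebesgue_measure R \x m)%E (@cons_row n).

Local Notation step := lebesgue_row_step.

Let step0 : step set0 = 0%E.
Proof. by rewrite /step /pushforward preimage_set0 measure0. Qed.

Let step_ge0 A : (0 <= step A)%E.
Proof. by rewrite /step /pushforward measure_ge0. Qed.

Let step_sigma_additive : semi_sigma_additive step.
Proof.
rewrite /step => F mF tF mUF; rewrite /pushforward preimage_bigcup.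
have mp A : measurable A -> measurable (@cons_row n @^-1` A).
  by move=> mA; rewrite -[X in measurable X]setTI; exact: measurable_cons_row.
apply: measure_semi_sigma_additive.
- by move=> k; exact: mp.
- apply/trivIsetP => /= i j _ _ ij; rewrite -preimage_setI.
  by move/trivIsetP : tF => /(_ _ _ _ _ ij) ->//; rewrite preimage_set0.
- by rewrite -preimage_bigcup; exact: mp.
Qed.

HB.instance Definition _ := isMeasure.Build _ _ _ step
  step0 step_ge0 step_sigma_additive.

Let step_sigma_finite : sigma_finite setT step.
Proof.
have /sigma_finiteP[F [TF ndF Foo]] := sigma_finiteT (@lebesgue_measure R).
have /sigma_finiteP[G [TG ndG Goo]] := sigma_finiteT m.
exists (fun k => @uncons_row n @^-1` (F k `*` G k)).
  rewrite -preimage_bigcup (_ : \bigcup_k _ = setT) ?preimage_setT//.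
  rewrite -setXTT TF TG predeqE => -[x y]; split.
    by move=> [k _ []/= ? ?]; split; exists k.
  move=> [/= [k _ Fkx] [l _ Gly]]; exists (maxn k l) => //; split.
  - by move: x Fkx; exact/subsetPset/ndF/leq_maxl.
  - by move: y Gly; exact/subsetPset/ndG/leq_maxr.
move=> k; have [mF Fk] := Foo k; have [mG Gk] := Goo k; split.
  rewrite -[X in measurable X]setTI.
  by apply: measurable_uncons_row => //; exact: measurableX.
rewrite /step /pushforward -comp_preimage.
rewrite (_ : _ \o _ = id); last by apply/funext => x; rewrite /= cons_rowK.
by rewrite preimage_id product_measure1E// lte_mul_pinfty// ge0_fin_numE.
Qed.

HB.instance Definition _ := Measure_isSigmaFinite.Build _ _ _ step
  step_sigma_finite.

End step.

Let lebesgue_row_spec n :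
  {m : {sigma_finite_measure set 'rV[R]_n -> \bar R} |
    (m : set 'rV[R]_n -> \bar R) = @lebesgue_row n}.
Proof.
elim: n => [|n [m mE]]; first by exists \d_(0 : 'rV[R]_0).
by exists (lebesgue_row_step m : {sigma_finite_measure set _ -> \bar R}); rewrite /= -mE.
Qed.

Let lebesgue_row0 n : @lebesgue_row n set0 = 0%E.
Proof. by case: (lebesgue_row_spec n) => m <-; exact: measure0. Qed.

Let lebesgue_row_ge0 n A : (0 <= @lebesgue_row n A)%E.
Proof. by case: (lebesgue_row_spec n) => m <-; exact: measure_ge0. Qed.

Let lebesgue_row_sigma_additive n : semi_sigma_additive (@lebesgue_row n).
Proof.
by case: (lebesgue_row_spec n) => m <-; exact: measure_semi_sigma_additive.
Qed.

HB.instance Definition _ n := isMeasure.Build _ _ _ (@lebesgue_row n)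
  (lebesgue_row0 n) (@lebesgue_row_ge0 n) (@lebesgue_row_sigma_additive n).

Let lebesgue_row_sigma_finite n : sigma_finite setT (@lebesgue_row n).
Proof. by case: (lebesgue_row_spec n) => m <-; exact: sigma_finiteT. Qed.

HB.instance Definition _ n := Measure_isSigmaFinite.Build _ _ _
  (@lebesgue_row n) (@lebesgue_row_sigma_finite n).

End lebesgue_row.

Section L2.
Context d (T : measurableType d) (R : realType) (mu : {measure set T -> \bar R}).
Local Open Scope quotient_scope.

Definition Lfun2 := LfunType mu (lee1n 2 : (1 <= 2%:E :> \bar R)%E).

HB.instance Definition _ := GRing.Lmodule.on Lfun2.

Definition Lfun2_fun (f : Lfun2) : T -> R := f.

Definition ae_zero : {pred Lfun2} :=
  fun f => `[< Lfun2_fun f = cst 0 %[ae mu] >].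

Lemma Lfun2_funD (f g : Lfun2) x :
  Lfun2_fun (f + g) x = Lfun2_fun f x + Lfun2_fun g x.
Proof. by []. Qed.

Lemma Lfun2_funB (f g : Lfun2) x :
  Lfun2_fun (f - g) x = Lfun2_fun f x - Lfun2_fun g x.
Proof. by []. Qed.

Lemma Lfun2_funZ a (f : Lfun2) x : Lfun2_fun (a *: f) x = a * Lfun2_fun f x.
Proof. by []. Qed.

Let ae_zero_zmod_closed : zmod_closed ae_zero.
Proof.
split=> [|f g /asboolP f0 /asboolP g0]; apply/asboolP; first exact: aeW.
by apply: filterS2 f0 g0 => x f0 g0 _; rewrite Lfun2_funB f0// g0// subrr.
Qed.

HB.instance Definition _ := GRing.isZmodClosed.Build Lfun2 ae_zero
  ae_zero_zmod_closed.

Let ae_zeroZ a (f : Lfun2) : f \in ae_zero -> a *: f \in ae_zero.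
Proof.
move=> /asboolP f0; apply/asboolP; apply: filterS f0 => x f0 _.
by rewrite Lfun2_funZ f0//= mulr0.
Qed.

Definition L2 : Type := Quotient.quot ae_zero.

HB.instance Definition _ := GRing.Zmodule.on L2.

Definition L2_class (f : Lfun2) : L2 := \pi_(Quotient.quot ae_zero) f.

Definition L2_repr (u : L2) : T -> R := Lfun2_fun (repr (u : Quotient.quot ae_zero)).
Coercion L2_repr : L2 >-> Funclass.

Definition L2_scale (a : R) (u : L2) : L2 :=
  L2_class (a *: repr (u : Quotient.quot ae_zero)).

Lemma L2_class_eq (f g : Lfun2) : f - g \in ae_zero -> L2_class f = L2_class g.
Proof. by move=> fg; apply/eqP; rewrite /L2_class -Quotient.idealrBE. Qed.

Lemma L2_class_reprB (f : Lfun2) : repr (L2_class f : Quotient.quot ae_zero) - f \in ae_zero.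
Proof. by rewrite Quotient.idealrBE reprK. Qed.

Lemma L2_class_scale a (f : Lfun2) : L2_scale a (L2_class f) = L2_class (a *: f).
Proof. by apply: L2_class_eq; rewrite -scalerBr; exact/ae_zeroZ/L2_class_reprB. Qed.

Lemma L2_classD (f g : Lfun2) : L2_class (f + g) = L2_class f + L2_class g.
Proof. exact: (Quotient.pi_add _ f g). Qed.

Lemma L2_ind (P : L2 -> Prop) : (forall f, P (L2_class f)) -> forall u, P u.
Proof.
by move=> h u; have := h (repr (u : Quotient.quot ae_zero)); rewrite /L2_class reprK.
Qed.

Let scaleA a b u : L2_scale a (L2_scale b u) = L2_scale (a * b) u.
Proof. by elim/L2_ind: u => f; rewrite !L2_class_scale scalerA. Qed.

Let scale1 : left_id 1 L2_scale.
Proof. by elim/L2_ind => f; rewrite L2_class_scale scale1r. Qed.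

Let scaleDr : right_distributive L2_scale +%R.
Proof.
move=> a; elim/L2_ind => f; elim/L2_ind => g.
by rewrite -L2_classD !L2_class_scale scalerDr L2_classD.
Qed.

Let scaleDl u : {morph L2_scale^~ u : a b / a + b}.
Proof. by move=> a b; elim/L2_ind: u => f; rewrite !L2_class_scale scalerDl L2_classD. Qed.

HB.instance Definition _ := GRing.Zmodule_isLmodule.Build R L2
  scaleA scale1 scaleDr scaleDl.

Definition L2_dot (u v : L2) : R := \int[mu]_x (u x * v x).

Definition L2_norm (u : L2) : R := Num.sqrt (L2_dot u u).

End L2.

Definition partial (R : realType) d (i : 'I_d) (f : 'rV[R]_d -> R) : 'rV[R]_d -> R :=
  fun x => 'D_(delta_mx ord0 i) f x.

Fixpoint class_C (R : realType) d k (f : 'rV[R]_d -> R) : Prop :=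
  continuous f /\
  if k is k'.+1 then
    forall i, (forall x, derivable f x (delta_mx ord0 i)) /\
              class_C k' (partial i f)
  else True.

(* Near every boundary point and up to relabelling and reorienting the axes
   (the choice of i and b), the set lies above the graph of a C^2 function of
   the other d - 1 coordinates, which col' i extracts. *)
Definition C2_boundary (R : realType) d (Om : set 'rV[R]_d) :=
  forall x, (closure Om `\` Om°) x ->
  exists i : 'I_d, exists b : bool, exists gamma : 'rV[R]_d.-1 -> R,
    class_C 2 gamma /\
    \forall y \near x, Om y <-> gamma (col' i y) < (-1) ^+ b * y ord0 i.

Section sobolev_spaces.
Variables (R : realType) (d : nat) (Om : set 'rV[R]_d) (oOm : open Om).

Definition test_function (phi : 'rV[R]_d -> R) :=
  [/\ forall k, class_C k phi, compact (closure [set x | phi x != 0]) &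
      closure [set x | phi x != 0] `<=` Om].

Definition lebesgue_on : {measure set 'rV[R]_d -> \bar R} :=
  mrestr (@lebesgue_row R d) (open_measurable_mx oOm).

Local Notation mu := lebesgue_on.
Local Notation L2Om := (L2 lebesgue_on).

Definition is_weak_partial (i : 'I_d) (u g : L2Om) :=
  forall phi, test_function phi ->
    \int[mu]_x (u x * partial i phi x) = - \int[mu]_x (g x * phi x).

(* The default value 0 is only taken when u has no weak derivative in L^2. *)
Definition weak_partial (i : 'I_d) (u : L2Om) : L2Om :=
  xget 0 [set g | is_weak_partial i u g].

Definition sobolev_H1 : set L2Om :=
  [set u | forall i, exists g, is_weak_partial i u g].

(* The H^1-closure of the test functions, whose weak derivatives are the
   classical ones. *)
Definition sobolev_H10 : set L2Om :=
  [set u | sobolev_H1 u /\ forall eps : R, 0 < eps ->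
    exists2 phi, test_function phi &
      \int[mu]_x (u x - phi x) ^+ 2 +
      \sum_i \int[mu]_x (weak_partial i u x - partial i phi x) ^+ 2 < eps].

Definition sobolev_H2 : set L2Om :=
  [set u | sobolev_H1 u /\ forall i, sobolev_H1 (weak_partial i u)].

Definition laplacian (u : L2Om) : L2Om :=
  \sum_i weak_partial i (weak_partial i u).

Definition H_space : set (L2Om * L2Om) := [set U | sobolev_H10 U.1].

(* A scalar product on H_space only: it does not see the L^2 norm of U.1,
   which the Poincare inequality controls on H^1_0 for bounded Om. *)
Definition H_dot (U W : L2Om * L2Om) : R :=
  \sum_i L2_dot (weak_partial i U.1) (weak_partial i W.1) + L2_dot U.2 W.2.

Definition H_norm (U : L2Om * L2Om) : R := Num.sqrt (H_dot U U).

Definition energy (U : L2Om * L2Om) : R :=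
  2^-1 * \int[mu]_x `|U.2 x| ^+ 2 +
  2^-1 * \int[mu]_x (\sum_i weak_partial i U.1 x ^+ 2).

Definition bounded_operator (P : L2Om -> L2Om) :=
  exists C : R, forall u, L2_norm (P u) <= C * L2_norm u.

Definition monotone_operator (P : L2Om -> L2Om) :=
  forall u, 0 <= L2_dot (P u) u.

Definition wave_domain : set (L2Om * L2Om) :=
  [set U | [/\ sobolev_H2 U.1, sobolev_H10 U.1 & sobolev_H10 U.2]].

Definition wave_operator (P : L2Om -> L2Om) (U : L2Om * L2Om) : L2Om * L2Om :=
  (- U.2, - laplacian U.1 + P U.2).

(* The values of S t outside H_space and for t < 0 are irrelevant. *)
Record contraction_semigroup (S : R -> L2Om * L2Om -> L2Om * L2Om) : Prop := {
  semigroup_H : forall t U, 0 <= t -> H_space U -> H_space (S t U) ;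
  semigroup_linear : forall t a U W, 0 <= t -> H_space U -> H_space W ->
    S t (a *: U + W) = a *: S t U + S t W ;
  semigroup_contraction : forall t U, 0 <= t -> H_space U ->
    H_norm (S t U) <= H_norm U ;
  semigroup0 : forall U, H_space U -> S 0 U = U ;
  semigroupD : forall s t U, 0 <= s -> 0 <= t -> H_space U ->
    S (s + t) U = S s (S t U) ;
  semigroup_continuous : forall U, H_space U ->
    H_norm (S t U - U) @[t --> 0^'+] --> (0 : R) }.

(* W ranges over all candidate limits in H_space, so D is exactly the set of
   the U where the difference quotient converges in H_space. *)
Definition infinitesimal_generator (S : R -> L2Om * L2Om -> L2Om * L2Om)
    (D : set (L2Om * L2Om)) (G : L2Om * L2Om -> L2Om * L2Om) :=
  forall U W, H_space U -> H_space W ->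
    (H_norm (h^-1 *: (S h U - U) - W) @[h --> 0^'+] --> (0 : R)) <->
    (D U /\ W = G U).

End sobolev_spaces.

(* Main.v *)
(* For a datum U0 in the domain of the generator, the curve t |-> S(t)U0 is
   differentiable in H; by Green's formula the gradient terms in the derivative of
   its energy cancel and only - <P v, v> remains, so the balance follows from the
   fundamental theorem of calculus.  Both sides of the balance are locally
   Lipschitz in U0, uniformly on bounded time intervals because S is a
   contraction, so the balance passes from the domain to its closure, which is H:
   pairs of test functions lie in the domain, and test functions are dense in L^2
   and (by definition) in H^1_0.  Density in L^2 also makes weak derivatives
   unique, which turns the choice operator weak_partial into a linear map. *)

Require Import Defs.
From HB Require Import structures.
From mathcomp Require Import all_boot all_order all_algebra.
From mathcomp Require Import all_classical all_reals all_analysis.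
From mathcomp Require Import measurable_realfun ring lra.

Set Implicit Arguments.
Unset Strict Implicit.
Unset Printing Implicit Defensive.
Import Order.TTheory GRing.Theory Num.Theory.
Import numFieldNormedType.Exports.
Local Open Scope classical_set_scope.
Local Open Scope ring_scope.

(** * Contraction semigroups on semi-inner-product spaces *)

Section bilinear_on_subspace.
Context {R : realType} {E : lmodType R}.
Implicit Types (H : set E) (b : E -> E -> R).

(** Two obstacles shape the proof. The operator [weak_partial] is linear only on [sobolev_H1], and
    [H_dot] is a form on all pairs of L^2 classes that behaves well only on [H_space]. The semigroup
    argument is therefore carried out for a semi-definite form that is bilinear relative to a
    subspace of an ambient module; its estimates rest on Cauchy-Schwarz. Density of test functions
    in L^2 is reached without mollifiers. Smooth cutoffs, made of products of one-variable functions
    of the type exp(-1/t), converge boundedly to the indicator of an open set, so the closed span of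
    the test functions contains these indicators; the open sets form a pi-system generating the
    Borel sets, and Dynkin's theorem does the rest. Integration by parts is proved only between test
    functions, where it reduces to the vanishing of the integral of a partial derivative on the
    whole space. Green's formula then comes from the definition of weak derivatives and
    approximation in [sobolev_H10], so no trace on the boundary is ever formed. *)

Definition lin_subspace H := H 0 /\ forall a U W, H U -> H W -> H (a *: U + W).

Definition bilinear_on H b :=
  (forall a U W Z, H U -> H W -> H Z -> b (a *: U + W) Z = a * b U Z + b W Z) /\
  (forall a U W Z, H U -> H W -> H Z -> b Z (a *: U + W) = a * b Z U + b Z W).

Definition semi_dot H b := [/\ bilinear_on H b,
  forall U W, H U -> H W -> b U W = b W U & forall U, H U -> 0 <= b U U].

Definition semi_norm b U : R := Num.sqrt (b U U).

Variable H : set E.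
Hypothesis H_sub : lin_subspace H.

Lemma subspaceD U W : H U -> H W -> H (U + W).
Proof. by move=> hU hW; rewrite -[U]scale1r; apply: (proj2 H_sub). Qed.

Lemma subspaceZ a U : H U -> H (a *: U).
Proof. by move=> hU; rewrite -[_ *: _]addr0; apply: (proj2 H_sub) => //; case: H_sub. Qed.

Lemma subspaceN U : H U -> H (- U).
Proof. by rewrite -scaleN1r; exact: subspaceZ. Qed.

Lemma subspaceB U W : H U -> H W -> H (U - W).
Proof. by move=> hU hW; apply: subspaceD => //; exact: subspaceN. Qed.

Section bilinear.
Variable b : E -> E -> R.
Hypothesis b_lin : bilinear_on H b.

Lemma bilinDl U W Z : H U -> H W -> H Z -> b (U + W) Z = b U Z + b W Z.
Proof. by move=> hU hW hZ; rewrite -[U in LHS]scale1r (proj1 b_lin)// mul1r. Qed.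

Lemma bilinDr U W Z : H U -> H W -> H Z -> b Z (U + W) = b Z U + b Z W.
Proof. by move=> hU hW hZ; rewrite -[U in LHS]scale1r (proj2 b_lin)// mul1r. Qed.

Lemma bilin0l Z : H Z -> b 0 Z = 0.
Proof.
move=> hZ; have h0 := proj1 H_sub.
by have /eqP := @bilinDl 0 0 Z h0 h0 hZ; rewrite addr0 -subr_eq0 opprD addrA subrr sub0r oppr_eq0 => /eqP.
Qed.

Lemma bilin0r Z : H Z -> b Z 0 = 0.
Proof.
move=> hZ; have h0 := proj1 H_sub.
by have /eqP := @bilinDr 0 0 Z h0 h0 hZ; rewrite addr0 -subr_eq0 opprD addrA subrr sub0r oppr_eq0 => /eqP.
Qed.

Lemma bilinZl a U Z : H U -> H Z -> b (a *: U) Z = a * b U Z.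
Proof.
by move=> hU hZ; rewrite -[_ *: _]addr0 (proj1 b_lin) ?bilin0l ?addr0//; case: H_sub.
Qed.

Lemma bilinZr a U Z : H U -> H Z -> b Z (a *: U) = a * b Z U.
Proof.
by move=> hU hZ; rewrite -[_ *: _]addr0 (proj2 b_lin) ?bilin0r ?addr0//; case: H_sub.
Qed.

Lemma bilinBl U W Z : H U -> H W -> H Z -> b (U - W) Z = b U Z - b W Z.
Proof.
move=> hU hW hZ; rewrite bilinDl//; last exact: subspaceN.
by rewrite -scaleN1r bilinZl// mulN1r.
Qed.

Lemma bilinBr U W Z : H U -> H W -> H Z -> b Z (U - W) = b Z U - b Z W.
Proof.
move=> hU hW hZ; rewrite bilinDr//; last exact: subspaceN.
by rewrite -scaleN1r bilinZr// mulN1r.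
Qed.

(** The difference telescopes through [b W U]. Symmetry is avoided on purpose: the dissipation form
    built from [P] need not be symmetric. *)
Lemma bilin_subdiag U W : H U -> H W -> b U U - b W W = b (U - W) U + b W (U - W).
Proof. by move=> hU hW; rewrite bilinBl// bilinBr//; ring. Qed.

End bilinear.

Variable dot : E -> E -> R.
Hypothesis dotP : semi_dot H dot.
Local Notation nm := (semi_norm dot).

Lemma semi_norm_ge0 U : 0 <= nm U. Proof. exact: sqrtr_ge0. Qed.

Lemma sqr_semi_norm U : H U -> nm U ^+ 2 = dot U U.
Proof. by move=> hU; rewrite sqr_sqrtr//; case: dotP => _ _; exact. Qed.

Lemma semi_CS U W : H U -> H W -> `|dot U W| <= nm U * nm W.
Proof.
move=> hU hW; case: (dotP) => bl sy ge0.
(* The usual quadratic polynomial in [a], nonnegative because the form is. *)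
have key a : 0 <= a ^+ 2 * dot U U + 2 * a * dot U W + dot W W.
  have := ge0 (a *: U + W); rewrite (proj1 bl)// ?(proj2 bl)//.
  - rewrite (sy W U)// => /(_ (proj2 H_sub _ _ _ hU hW)); congr (_ <= _); ring.
  - exact: (proj2 H_sub).
have d2 : dot U W ^+ 2 <= dot U U * dot W W.
  have := ge0 U hU; rewrite le_eqVlt => /predU1P[U0|U0].
    (* If [dot U U] is 0 the polynomial is affine in [a]; were its slope nonzero, the chosen [a]
       would give it the value -1. *)
    have [->|uw] := eqVneq (dot U W) 0; first by rewrite expr0n/= -U0 mul0r.
    have := key (- (dot W W + 1) / (2 * dot U W)); rewrite -U0 mulr0 add0r.
    rewrite (_ : 2 * _ * _ = - (dot W W + 1)); last by field.
    by rewrite opprD addrAC addNr add0r leNgt oppr_lt0 ltr01.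
  have := mulr_ge0 (ltW U0) (key (- dot U W / dot U U)).
  rewrite -[_ <= dot U U * dot W W]subr_ge0; congr (_ <= _).
  by field; rewrite gt_eqF.
rewrite -sqrtrM ?ge0// -sqrtr_sqr ler_wsqrtr//.
Qed.

Lemma semi_normZ a U : H U -> nm (a *: U) = `|a| * nm U.
Proof.
move=> hU; rewrite /semi_norm; case: dotP => bl _ _.
rewrite (bilinZl bl)// ?(bilinZr bl)//; last exact: subspaceZ.
by rewrite mulrA -expr2 sqrtrM ?sqr_ge0// sqrtr_sqr.
Qed.

Lemma semi_normN U : H U -> nm (- U) = nm U.
Proof. by move=> hU; rewrite -scaleN1r semi_normZ// normrN1 mul1r. Qed.

Lemma semi_norm_subC U W : H U -> H W -> nm (U - W) = nm (W - U).
Proof. by move=> hU hW; rewrite -semi_normN ?opprB//; exact: subspaceB. Qed.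

Lemma semi_normD U W : H U -> H W -> nm (U + W) <= nm U + nm W.
Proof.
move=> hU hW; case: (dotP) => bl sy _.
rewrite -(@ler_pXn2r _ 2)// ?nnegrE ?addr_ge0 ?semi_norm_ge0//.
have hUW := subspaceD hU hW.
rewrite sqr_semi_norm// (bilinDl bl)// !(bilinDr bl)// (sy W U)//.
have := semi_CS hU hW; rewrite sqrrD !sqr_semi_norm// => /(le_trans (ler_norm _)).
by move: (nm U * nm W) => c; lra.
Qed.

Lemma semi_norm_sub U W Z : H U -> H W -> H Z -> nm (U - W) <= nm (U - Z) + nm (Z - W).
Proof.
move=> hU hW hZ; rewrite -(subrKA Z U (- W)) semi_normD//; exact: subspaceB.
Qed.

Lemma semi_norm_le U W : H U -> H W -> nm U <= nm (U - W) + nm W.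
Proof. by move=> hU hW; rewrite -{1}(subrK W U) semi_normD//; exact: subspaceB. Qed.

(** The local Lipschitz estimate behind both the continuity in time of quadratic quantities and the
    passage from the domain to its closure. *)
Lemma quad_lip b C U W : bilinear_on H b ->
  (forall U W, H U -> H W -> `|b U W| <= C * (nm U * nm W)) -> H U -> H W ->
  `|b U U - b W W| <= C * (nm (U - W) * (nm U + nm W)).
Proof.
move=> bl bC hU hW; rewrite (bilin_subdiag bl)// (le_trans (ler_normD _ _))//.
have hB := subspaceB hU hW.
by rewrite 2!mulrDr lerD// ?bC// [X in C * X]mulrC bC.
Qed.

End bilinear_on_subspace.

(** * Orbits of a contraction semigroup and their energy balance *)

Section energy_balance.
Context {R : realType} {E : lmodType R} (H : set E) (dot : E -> E -> R).
Hypotheses (H_sub : lin_subspace H) (dotP : semi_dot H dot).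
Local Notation nm := (semi_norm dot).
Local Notation mu := (@lebesgue_measure R).

Variable T : R -> E -> E.
Hypothesis T_in : forall (t : R) U, 0 <= t -> H U -> H (T t U).
Hypothesis T_linear : forall (t : R) a U W, 0 <= t -> H U -> H W ->
  T t (a *: U + W) = a *: T t U + T t W.
Hypothesis T_contraction : forall (t : R) U, 0 <= t -> H U -> nm (T t U) <= nm U.
Hypothesis T_0 : forall U, H U -> T 0 U = U.
Hypothesis T_add : forall (s t : R) U, 0 <= s -> 0 <= t -> H U ->
  T (s + t) U = T s (T t U).
Hypothesis T_continuous : forall U, H U -> nm (T t U - U) @[t --> 0^'+] --> (0 : R).

Lemma semigroupB t U W : 0 <= t -> H U -> H W -> T t (U - W) = T t U - T t W.
Proof.
move=> t0 hU hW; rewrite addrC -scaleN1r T_linear// scaleN1r addrC//.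
Qed.

Lemma semigroupZ t a U : 0 <= t -> H U -> T t (a *: U) = a *: T t U.
Proof.
move=> t0 hU; have [H0 _] := H_sub.
have T00 : T t 0 = 0 by rewrite -[X in T t X](subrr (0 : E)) semigroupB// subrr.
by rewrite -[a *: U]addr0 T_linear// T00 addr0.
Qed.

Lemma at_right0_lt (f : R -> R) e : f @ 0^'+ --> (0 : R) -> 0 < e ->
  exists2 k, 0 < k & forall h, 0 < h -> h < k -> `|f h| < e.
Proof.
move=> /cvgrPdist_lt /[apply]; rewrite !near_withinE => -[k /= k0 fk].
exists k => // h h0 hk; have := fk h; rewrite /= !sub0r !normrN gtr0_norm//.
exact.
Qed.

(** Strong continuity is assumed only at 0 from the right. For s <= r the increment is [T s] applied
    to T (r - s) U - U, and the contraction property bounds it by the increment at 0, whichever of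
    the two times is held fixed. *)
Lemma semigroup_curve_continuous U t e : H U -> 0 <= t -> 0 < e ->
  exists2 k, 0 < k & forall s, 0 <= s -> `|s - t| < k -> nm (T s U - T t U) < e.
Proof.
move=> hU t0 e0; have [k k0 hk] := at_right0_lt (T_continuous hU) e0.
have small h : 0 <= h -> h < k -> nm (T h U - U) < e.
  rewrite le_eqVlt => /predU1P[<-|h0] hk'.
    rewrite T_0// subrr; case: dotP => bl _ _.
    by rewrite /semi_norm (bilin0l H_sub bl) ?sqrtr0//; case: H_sub.
  exact: le_lt_trans (ler_norm _) (hk _ h0 hk').
have main s r : 0 <= s -> s <= r -> r - s < k -> nm (T r U - T s U) < e.
  move=> s0 sr rsk; have rs0 : 0 <= r - s by rewrite subr_ge0.
  have hB := subspaceB H_sub (T_in rs0 hU) hU.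
  rewrite -{1}(subrKC s r) T_add// -semigroupB//; last exact: T_in.
  by rewrite (le_lt_trans (T_contraction _ _))// small.
exists k => // s s0; case: (leP s t) => st.
  rewrite distrC ger0_norm ?subr_ge0// => stk.
  by rewrite (semi_norm_subC H_sub dotP) ?main//; exact: T_in.
by rewrite ger0_norm ?subr_ge0 1?ltW// => stk; rewrite main// ltW.
Qed.

Section quadratic.
Variables (b : E -> E -> R) (C : R).
Hypotheses (b_lin : bilinear_on H b) (C_ge0 : 0 <= C).
Hypothesis bC : forall U W, H U -> H W -> `|b U W| <= C * (nm U * nm W).

Lemma quad_curve_continuous U t : H U ->
  {within `[0, t], continuous (fun s => b (T s U) (T s U))}.
Proof.
move=> hU; apply/subspace_continuousP => x /=; rewrite in_itv/= => /andP[x0 xt].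
apply/cvgrPdist_lt => e e0.
(* [quad_lip] and contraction give the Lipschitz factor 2 C |U| along the orbit; the extra 1 keeps
   the divisor positive. *)
have M0 : 0 < 2 * C * (nm U) + 1.
  by rewrite ltr_pwDr// !mulr_ge0// semi_norm_ge0.
have [k k0 hk] := semigroup_curve_continuous hU x0 (divr_gt0 e0 M0).
near=> y.
have y0 : 0 <= y.
  have : `[0, t]%classic y by near: y; exact: withinT.
  by rewrite /= in_itv/= => /andP[].
have /hk : `|y - x| < k.
  near: y; apply: cvg_within; apply/nbhs_ballP; exists k => // z.
  by rewrite /ball/= distrC.
move=> /(_ y0); rewrite ltr_pdivlMr// => lt_e; rewrite distrC.
apply: le_lt_trans lt_e.
rewrite (le_trans (quad_lip H_sub b_lin bC (T_in y0 hU) (T_in x0 hU)))//.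
have := T_contraction y0 hU; have := T_contraction x0 hU.
have := semi_norm_ge0 dot (T y U - T x U).
move: (nm (T y U - _)) (nm (T y U)) (nm (T x U)) (nm U) => p q r s p0 qs rs.
have : C * (p * (q + r)) <= C * (p * (s + s)) by rewrite !ler_wpM2l// lerD.
move=> hC; apply: (le_trans hC).
by nra.
Unshelve. all: by end_near. Qed.

Lemma quad_curve_integrable U t : H U ->
  mu.-integrable `[0, t] (fun s => (b (T s U) (T s U))%:E).
Proof.
move=> hU; apply: continuous_compact_integrable; first exact: segment_compact.
exact: quad_curve_continuous.
Qed.

End quadratic.

Variables (D : set E) (G : E -> E).
Hypothesis D_sub : D `<=` H.
Hypothesis G_in : forall U, D U -> H (G U).
Hypothesis T_generator : forall U W, H U -> H W ->
  (nm (h^-1 *: (T h U - U) - W) @[h --> 0^'+] --> (0 : R)) <-> (D U /\ W = G U).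

Lemma diff_quotient_in h U : 0 <= h -> H U -> H (h^-1 *: (T h U - U)).
Proof.
by move=> h0 hU; apply: subspaceZ => //; apply: subspaceB => //; exact: T_in.
Qed.

Lemma diff_quotient_shift h t U W : 0 <= h -> 0 <= t -> H U -> H W ->
  h^-1 *: (T (t + h) U - T t U) - T t W = T t (h^-1 *: (T h U - U) - W).
Proof.
move=> h0 t0 hU hW; have hq := diff_quotient_in h0 hU.
have hT := T_in h0 hU; have hB := subspaceB H_sub hT hU.
by rewrite T_add// -(semigroupB t0 hT hU) -semigroupZ// -semigroupB.
Qed.

(** The quotient of the shifted orbit is [T t] of the original quotient, so it converges to T t (G
    U). The generator hypothesis is an equivalence: this convergence yields both membership in [D]
    and the value of [G]. *)
Lemma semigroup_generator_comm t U : 0 <= t -> D U ->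
  D (T t U) /\ T t (G U) = G (T t U).
Proof.
move=> t0 dU; have hU := D_sub dU; have hG := G_in dU.
apply/T_generator; [exact: T_in|exact: T_in|].
have /cvgrPdist_lt cvG := (T_generator hU hG).2 (conj dU erefl).
apply/cvgrPdist_lt => e /cvG; apply: filterS2 (nbhs_right_ge 0) => h h0.
rewrite !sub0r !normrN !ger0_norm ?semi_norm_ge0//; apply: le_lt_trans.
rewrite -T_add// [h + t]addrC diff_quotient_shift// T_contraction//.
by apply: subspaceB => //; exact: diff_quotient_in.
Qed.

(** The generator supplies only a right derivative at 0. The two-sided one follows by always basing
    the quotient at the earlier time. *)
Lemma semigroup_derivative U (x e : R) : D U -> 0 < x -> 0 < e ->
  exists2 k, 0 < k & forall h, h != 0 -> `|h| < k ->
    0 <= x + h /\ nm (h^-1 *: (T (x + h) U - T x U) - T x (G U)) < e.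
Proof.
move=> dU x0 e0; have hU := D_sub dU; have hG := G_in dU.
have e20 : 0 < e / 2 by rewrite divr_gt0.
have [k1 k10 hk1] := at_right0_lt ((T_generator hU hG).2 (conj dU erefl)) e20.
have [k2 k20 hk2] := semigroup_curve_continuous hG (ltW x0) e20.
(* The bound by [x] keeps x + h nonnegative, where the semigroup laws hold. *)
exists (Num.min x (Num.min k1 k2)); first by rewrite !lt_min x0 k10.
move=> h hn0; rewrite !lt_min => /and3P[hx h1 h2].
have xh0 : 0 <= x + h.
  by rewrite -lerBlDl sub0r; move: hx; rewrite ltr_norml => /andP[/ltW].
split => //.
(* Here s is the earlier of x and x + h. The quotient is close to T s (G U), which is close to T x
   (G U) by continuity of the orbit of [G U]; the second error is zero when h > 0. *)
have main s r : 0 <= s -> s < r -> r - s < k1 -> `|s - x| < k2 ->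
    nm ((r - s)^-1 *: (T r U - T s U) - T x (G U)) < e.
  move=> s0 sr rs1 sx2; have rs0 : 0 <= r - s by rewrite subr_ge0 ltW.
  have := diff_quotient_shift rs0 s0 hU hG; rewrite subrKC => q1.
  have hq : H ((r - s)^-1 *: (T r U - T s U)).
    apply: subspaceZ => //; apply: subspaceB => //; apply: T_in => //.
    by rewrite (le_trans s0)// ltW.
  have hq' := subspaceB H_sub (diff_quotient_in rs0 hU) hG.
  rewrite (le_lt_trans (semi_norm_sub H_sub dotP hq _ (T_in s0 hG)))//.
    by apply: T_in => //; exact: ltW.
  rewrite [ltRHS]splitr ltrD ?hk2// q1 (le_lt_trans (T_contraction _ _))//.
  by rewrite (le_lt_trans (ler_norm _))// hk1 ?subr_gt0.
move: hn0; rewrite neq_lt => /orP[hlt|hgt].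
- rewrite -[T (x + h) U - _]opprB scalerN -scaleNr -invrN.
  have -> : - h = x - (x + h) by rewrite opprD addrA subrr sub0r.
  apply: main => //.
  + by rewrite gtrDl.
  + by rewrite opprD addrA subrr sub0r -ltr0_norm.
  + by rewrite addrAC subrr add0r.
- rewrite -{1}[h](addrK x) [h + x]addrC; apply: main => //; first exact: ltW.
  + by rewrite ltrDl.
  + by rewrite addrAC subrr add0r -[h]gtr0_norm.
  + by rewrite subrr normr0.
Qed.

Lemma is_derive_energy U (x : R) : D U -> 0 < x ->
  is_derive x 1 (fun t => dot (T t U) (T t U)) (2 * dot (T x (G U)) (T x U)).
Proof.
move=> dU x0; have hU := D_sub dU; have hG := G_in dU.
have [bl sy _] := dotP.
have x0' := ltW x0.
set f := fun t => _; set l := _ * _.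
suff cv : (fun h : R => h^-1 *: (f (h *: 1 + x) - f x)) @ 0^' --> l.
  by apply: DeriveDef; [apply/cvg_ex; exists l|exact/cvg_lim].
apply/cvgrPdist_lt => e e0.
pose M := nm U + nm (G U) + 1.
have M0 : 0 < M by rewrite /M ltr_pwDr// addr_ge0// semi_norm_ge0.
have UM : nm U <= M by rewrite /M -addrA lerDl addr_ge0// semi_norm_ge0.
have GM : nm (G U) <= M by rewrite /M addrAC lerDr addr_ge0// semi_norm_ge0.
(* Of the three shares of [e], two pay for the error in the difference quotient, paired with a sum
   of norm at most 2 M, and one for the increment of the orbit, paired with T x (G U), of norm at
   most M. *)
have eta0 : 0 < e / (3 * M) by rewrite divr_gt0// mulr_gt0.
have [k1 k10 hk1] := semigroup_derivative dU x0 eta0.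
have [k2 k20 hk2] := semigroup_curve_continuous hU x0' eta0.
near=> h.
have hn0 : h != 0 by near: h; exact: nbhs_dnbhs_neq.
have hk : `|h| < Num.min k1 k2.
  near: h; apply: dnbhs0_lt.
  by rewrite lt_min k10.
move: hk; rewrite lt_min => /andP[h1 h2].
have [xh0 lt1] := hk1 h hn0 h1.
have lt2 : nm (T (x + h) U - T x U) < e / (3 * M).
  by apply: hk2 => //; rewrite addrAC subrr add0r.
have hx := T_in x0' hU; have hxh := T_in xh0 hU; have hgx := T_in x0' hG.
have hd := subspaceB H_sub hxh hx.
have hq := subspaceZ H_sub h^-1 hd.
have hs := subspaceD H_sub hxh hx.
rewrite /f [h *: 1]mulr1 [h + x]addrC.
(* Difference of two squares: by symmetry of [dot], it factors as the increment paired with the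
   sum. *)
have -> : h^-1 *: (dot (T (x + h) U) (T (x + h) U) - dot (T x U) (T x U)) =
    dot (h^-1 *: (T (x + h) U - T x U)) (T (x + h) U + T x U).
  rewrite (bilinZl H_sub bl)// (bilinDr bl)// (bilin_subdiag H_sub bl)//.
  by rewrite [X in dot _ _ + X]sy.
set q := _ *: (T _ _ - _) in hq lt1 *.
have -> : l - dot q (T (x + h) U + T x U) =
    - (dot (q - T x (G U)) (T (x + h) U + T x U) +
      dot (T x (G U)) (T (x + h) U - T x U)).
  rewrite (bilinBl H_sub bl)// (bilinBr H_sub bl)// (bilinDr bl hxh hx hgx) /l.
  by ring.
rewrite normrN (le_lt_trans (ler_normD _ _))//.
have hqB := subspaceB H_sub hq hgx.
have c1 := semi_CS H_sub dotP hqB hs.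
have c2 := semi_CS H_sub dotP hgx hd.
have c3 : nm (T (x + h) U + T x U) <= 2 * M.
  rewrite (le_trans (semi_normD H_sub dotP hxh hx))//.
  have := T_contraction xh0 hU; have := T_contraction x0' hU.
  by move: UM; lra.
have c4 : nm (T x (G U)) <= M by rewrite (le_trans (T_contraction _ _)).
have e3 : e = 3 * M * (e / (3 * M)) by field; rewrite gt_eqF.
rewrite e3 (_ : 3 * M * _ = e / (3 * M) * (2 * M) + M * (e / (3 * M))); last by ring.
apply: ltr_leD.
  apply: (le_lt_trans c1); apply: (@le_lt_trans _ _ (nm (q - T x (G U)) * (2 * M))).
    by rewrite ler_wpM2l// semi_norm_ge0.
  by rewrite ltr_pM2r// mulr_gt0.
by apply: (le_trans c2); rewrite ler_pM ?semi_norm_ge0// ltW.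
Unshelve. all: by end_near. Qed.

Variables (b : E -> E -> R) (C : R).
Hypotheses (b_lin : bilinear_on H b) (C_ge0 : 0 <= C).
Hypothesis bC : forall U W, H U -> H W -> `|b U W| <= C * (nm U * nm W).
Hypothesis G_diss : forall U, D U -> dot (G U) U = - b U U.
Hypothesis D_dense : forall U (e : R), H U -> 0 < e -> exists2 W, D W & nm (U - W) < e.

Let dot_bound U W : H U -> H W -> `|dot U W| <= 1 * (nm U * nm W).
Proof. by move=> hU hW; rewrite mul1r (semi_CS H_sub dotP). Qed.

Lemma energy_balance_domain U (t : R) : D U -> 0 <= t ->
  dot (T t U) (T t U) + 2 * \int[mu]_(s in `[0, t]) b (T s U) (T s U) = dot U U.
Proof.
move=> dU; have hU := D_sub dU; have [bl _ _] := dotP.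
(* The fundamental theorem is applied on a nondegenerate interval, so t = 0 is separated. For t > 0
   it asks for derivatives inside only, with continuity at both ends. *)
rewrite le_eqVlt => /predU1P[<-|t0].
  by rewrite T_0// set_itv1 Rintegral_set1 mulr0 addr0.
have ct := quad_curve_continuous bl ler01 dot_bound (t := t) hU.
have /(continuous_within_itvP _ t0) [_ c0 c1] := ct.
have cb := quad_curve_continuous b_lin C_ge0 bC (t := t) hU.
pose f s := - 2 * b (T s U) (T s U).
have cf : {within `[0, t], continuous f}.
  by move=> s; apply: cvgM; [exact: cvg_cst|exact: cb].
have ib := quad_curve_integrable b_lin C_ge0 bC t hU.
have dE x : x \in `]0, t[ -> is_derive x 1 (fun s => dot (T s U) (T s U)) (f x).
  rewrite in_itv/= => /andP[x0 _].
  apply: is_derive_eq (is_derive_energy dU x0) _.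
  have [dx ->] := semigroup_generator_comm (ltW x0) dU.
  by rewrite G_diss// mulrN -mulNr.
have := continuous_FTC2 t0 cf _ _.
move=> /(_ (fun s => dot (T s U) (T s U))) => ftc.
have : \int[mu]_(s in `[0, t]) f s = dot (T t U) (T t U) - dot (T 0 U) (T 0 U).
  rewrite /Rintegral ftc//.
  - by split => // x xt; exact: (@ex_derive _ _ _ _ _ _ _ (dE x xt)).
  - by move=> x xt; rewrite derive1E; exact: (@derive_val _ _ _ _ _ _ _ (dE x xt)).
rewrite /f RintegralZl// T_0// => /eqP; rewrite eq_sym subr_eq => /eqP ->.
by ring.
Qed.

Theorem semigroup_energy_balance U (t : R) : H U -> 0 <= t ->
  dot (T t U) (T t U) + 2 * \int[mu]_(s in `[0, t]) b (T s U) (T s U) = dot U U.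
Proof.
move=> hU t0; have [bl _ _] := dotP.
apply/eqP; rewrite -subr_eq0 -normr_le0; apply/ler_addgt0Pl => e e0.
rewrite addr0.
(* The energies at times t and 0 each change by at most d (2 |U| + 1) when U is replaced by W at
   distance d, and twice the integral by at most 2 C t times that. The last 1 makes K positive. *)
pose K := (2 + 2 * C * t) * (2 * nm U + 1) + 1.
have nU0 := semi_norm_ge0 dot U.
have K0 : 0 < K by rewrite ltr_pwDr// mulr_ge0// addr_ge0// !mulr_ge0.
(* Distance below 1 gives |W| <= |U| + 1, hence the factor 2 |U| + 1; distance below e / K makes the
   total error at most [e]. *)
have d0 : 0 < Num.min 1 (e / K) by rewrite lt_min ltr01 divr_gt0.
have [W dW] := D_dense hU d0; rewrite lt_min => /andP[UW1 UWe].
have hW := D_sub dW; have hB := subspaceB H_sub hU hW.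
have nWU : nm W <= nm U + 1.
  rewrite (le_trans (semi_norm_le H_sub dotP hW hU))// addrC lerD2l.
  by rewrite (semi_norm_subC H_sub dotP)// ltW.
pose d := nm (U - W).
have lip (c : E -> E -> R) k s : bilinear_on H c -> 0 <= k ->
    (forall U W, H U -> H W -> `|c U W| <= k * (nm U * nm W)) -> 0 <= s ->
    `|c (T s U) (T s U) - c (T s W) (T s W)| <= k * (d * (2 * nm U + 1)).
  move=> c_lin k0 ck s0.
  rewrite (le_trans (quad_lip H_sub c_lin ck (T_in s0 hU) (T_in s0 hW)))// ler_wpM2l//.
  rewrite ler_pM ?addr_ge0 ?semi_norm_ge0//.
    by rewrite -semigroupB// T_contraction.
  have := T_contraction s0 hU; have := T_contraction s0 hW; move: nWU; lra.
have lip_t := lip _ _ _ bl ler01 dot_bound t0.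
have := lip _ _ _ bl ler01 dot_bound (lexx 0); rewrite !T_0// => lip_0.
have iU := quad_curve_integrable b_lin C_ge0 bC t hU.
have iW := quad_curve_integrable b_lin C_ge0 bC t hW.
have lip_int : `|\int[mu]_(s in `[0, t]) b (T s U) (T s U) -
    \int[mu]_(s in `[0, t]) b (T s W) (T s W)| <= C * (d * (2 * nm U + 1)) * t.
  rewrite -RintegralB//; apply: le_trans (le_normr_Rintegral _ _) _ => //.
    exact: (integrableB _ iU iW).
  have -> : C * (d * (2 * nm U + 1)) * t =
      \int[mu]_(s in `[0, t]) cst (C * (d * (2 * nm U + 1))) s.
    rewrite Rintegral_cst//= lebesgue_measure_itv/= lte_fin.
    by case: ltP t0 => [_ _|t0' t0]/=; rewrite ?subr0// (@le_anti _ _ t 0) ?t0 ?t0'.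
  apply: le_Rintegral => //.
  - exact: (integrable_norm (integrableB _ iU iW)).
  - apply: continuous_compact_integrable; first exact: segment_compact.
    by move=> x; exact: cvg_cst.
  - by move=> s /=; rewrite in_itv/= => /andP[s0 _]; exact: lip.
have := energy_balance_domain dW t0.
set IU := Rintegral _ _ _ in lip_int *; set IW := Rintegral _ _ _ in lip_int *.
move=> bal.
have -> : dot (T t U) (T t U) + 2 * IU - dot U U =
    (dot (T t U) (T t U) - dot (T t W) (T t W)) + 2 * (IU - IW)
    - (dot U U - dot W W) by rewrite -bal; ring.
have dK : d * K <= e by rewrite -ler_pdivlMr// ltW.
apply: le_trans dK; rewrite (le_trans (ler_normB _ _))//.
rewrite (le_trans (lerD (ler_normD _ _) (lexx _)))// normrM ger0_norm//.
have d0' : 0 <= d := semi_norm_ge0 dot _.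
rewrite /K; move: lip_t lip_0 lip_int; rewrite !mul1r.
move: `|_| `|_| `|_| => p1 p2 p3 h1 h2 h3.
rewrite (le_trans (lerD (lerD h1 (ler_wpM2l _ h3)) h2))//.
by rewrite -subr_ge0; apply: le_trans d0' _; rewrite le_eqVlt; apply/orP; left; apply/eqP; ring.
Qed.

End energy_balance.

(** * The space L^2 *)

Section L2_dot_theory.
Context d (T : measurableType d) (R : realType) (mu : {measure set T -> \bar R}).
Implicit Types (u v w : L2 mu) (f g : T -> R).
Local Notation Lf := (Lfun mu 2%:E).

Lemma Lfun2_measurable f : f \in Lf -> measurable_fun setT f.
Proof. by rewrite inE => /andP[]; rewrite inE. Qed.

Lemma Lfun2_lin a f g : f \in Lf -> g \in Lf -> (fun x => a * f x + g x) \in Lf.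
Proof.
have [_ h] := @Lfun_submod_closed _ _ _ mu 2%:E (lee1n 2).
exact: h.
Qed.

Lemma Lfun2_mul_integrable f g : f \in Lf -> g \in Lf ->
  mu.-integrable setT (fun x => (f x * g x)%:E).
Proof. by move=> hf hg; have /Lfun1_integrable := Lfun2_mul_Lfun1 hf hg. Qed.

Lemma Rintegral_ae f g : measurable_fun setT f -> measurable_fun setT g ->
  f = g %[ae mu] -> \int[mu]_x f x = \int[mu]_x g x.
Proof.
move=> mf mg fg; rewrite /Rintegral; congr fine; apply: ae_eq_integral => //.
- exact/measurable_EFinP.
- exact/measurable_EFinP.
- by apply: filterS fg => x /= fg /fg ->.
Qed.

Lemma L2_Lfun u : (u : T -> R) \in Lf.
Proof. exact: LfunP. Qed.

Lemma L2_eq u v : u = v %[ae mu] -> u = v.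
Proof.
move=> uv; rewrite -[u]reprK -[v]reprK; apply: L2_class_eq.
apply/asboolP; apply: filterS uv => x uv /uv; rewrite Lfun2_funB => /eqP.
by rewrite -subr_eq0 => /eqP.
Qed.

Lemma L2_classE (F : Lfun2 mu) : L2_class F = Lfun2_fun F %[ae mu].
Proof.
have /asboolP := L2_class_reprB F; apply: filterS => x h /h.
by rewrite Lfun2_funB => /eqP; rewrite subr_eq0 => /eqP.
Qed.

(** The coercion evaluates a chosen representative, and choosing does not commute with addition:
    pointwise algebra on classes is available only almost everywhere. *)
Lemma L2_addE u v : (u + v : L2 mu) = (fun x => u x + v x) %[ae mu].
Proof.
have -> : u + v = L2_class (repr (u : Quotient.quot _) + repr (v : Quotient.quot _)).
  by rewrite L2_classD /L2_class !reprK.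
exact: L2_classE.
Qed.

Lemma L2_scaleE a u : (a *: u : L2 mu) = (fun x => a * u x) %[ae mu].
Proof. exact: L2_classE. Qed.

Definition L2_of f (hf : f \in Lf) : L2 mu :=
  L2_class (Lfun_Sub (lee1n 2 : (1 <= 2%:E :> \bar R)%E) hf : Lfun2 mu).

Lemma L2_ofE f (hf : f \in Lf) : L2_of hf = f %[ae mu].
Proof. exact: L2_classE. Qed.

Lemma L2_eqP f u (hf : f \in Lf) : f = u %[ae mu] -> L2_of hf = u.
Proof. by move=> fu; apply: L2_eq; apply: ae_eq_trans fu; exact: L2_ofE. Qed.

Lemma L2_dotE u v f g : f \in Lf -> g \in Lf ->
  u = f %[ae mu] -> v = g %[ae mu] -> L2_dot u v = \int[mu]_x (f x * g x).
Proof.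
move=> hf hg uf vg; apply: Rintegral_ae.
- by apply: measurable_funM; exact/Lfun2_measurable/L2_Lfun.
- by apply: measurable_funM; exact/Lfun2_measurable.
- by apply: filterS2 uf vg => x uf vg xT; rewrite uf ?vg.
Qed.

Lemma L2_dot_ofr u f (hf : f \in Lf) : L2_dot u (L2_of hf) = \int[mu]_x (u x * f x).
Proof.
by apply: L2_dotE => //; [exact: L2_Lfun|exact: ae_eq_refl|exact: L2_ofE].
Qed.

(** Turns the raw integrals in the definition of [sobolev_H10] into squared norms of classes. *)
Lemma L2_dot_sqrB u f (hf : f \in Lf) :
  L2_dot (u - L2_of hf) (u - L2_of hf) = \int[mu]_x (u x - f x) ^+ 2.
Proof.
have h : (fun x => u x - f x) \in Lf.
  rewrite (_ : (fun _ => _) = (fun x => -1 * f x + u x)).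
    by apply: Lfun2_lin => //; exact: L2_Lfun.
  by apply/funext => x; rewrite mulN1r addrC.
have e : (u - L2_of hf : L2 mu) = (fun x => u x - f x) %[ae mu].
  have -> : u - L2_of hf = u + (-1) *: L2_of hf by rewrite scaleN1r.
  apply: filterS3 (L2_addE u (-1 *: L2_of hf)) (L2_scaleE (-1) (L2_of hf)) (L2_ofE hf).
  by move=> x e1 e2 e3 xT; rewrite e1// e2// e3// mulN1r.
by rewrite (L2_dotE h h e e).
Qed.

Lemma semi_dot_L2 : semi_dot [set: L2 mu] (@L2_dot _ _ _ mu).
Proof.
have dotC u v : L2_dot u v = L2_dot v u.
  by apply: eq_Rintegral => x _; rewrite mulrC.
have dotl a u v w : L2_dot (a *: u + v) w = a * L2_dot u w + L2_dot v w.
  have iu := Lfun2_mul_integrable (L2_Lfun u) (L2_Lfun w).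
  have iv := Lfun2_mul_integrable (L2_Lfun v) (L2_Lfun w).
  rewrite /L2_dot -RintegralZl// -RintegralD//; last first.
    by have := integrableZl measurableT a iu; exact: eq_integrable.
  apply: Rintegral_ae.
  - by apply: measurable_funM; exact/Lfun2_measurable/L2_Lfun.
  - apply: measurable_funD; first apply: measurable_funM => //;
      by apply: measurable_funM; exact/Lfun2_measurable/L2_Lfun.
  - apply: filterS2 (L2_addE (a *: u) v) (L2_scaleE a u).
    by move=> x e1 e2 xT; rewrite e1// e2// mulrDl mulrA.
split => //.
- by split=> a u v w _ _ _; rewrite ?dotl// dotC dotl dotC (dotC v).
- by move=> u _; apply: Rintegral_ge0 => x _; rewrite -expr2 sqr_ge0.
Qed.

Lemma lin_subspaceT : lin_subspace [set: L2 mu]. Proof. by []. Qed.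

Lemma L2_dot_eq0 u : L2_dot u u = 0 -> u = 0.
Proof.
move=> u0; apply: L2_eq.
have iu := Lfun2_mul_integrable (L2_Lfun u) (L2_Lfun u).
have := iu => /integrableP[mu2 _].
have : (\int[mu]_x `|(u x * u x)%:E| = 0)%E.
  under eq_integral do rewrite gee0_abs ?lee_fin -?expr2 ?sqr_ge0//.
  move: u0; rewrite /L2_dot /Rintegral => u0.
  have := integrable_fin_num measurableT iu.
  by under eq_integral do rewrite -expr2; move=> /fineK <-;
    move: u0; under eq_integral do rewrite -expr2; move=> ->.
move=> /(ae_eq_integral_abs _ measurableT mu2) e.
have z : (0 : L2 mu) = cst 0 %[ae mu].
  rewrite -(scale0r (0 : L2 mu)); apply: filterS (L2_scaleE 0 0) => x h xT.
  by rewrite h// mul0r.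
apply: filterS2 e z => x e z xT; rewrite z//.
by have /eqP := e xT; rewrite eqe mulf_eq0 orbb => /eqP.
Qed.

Lemma L2_norm_semi u : L2_norm u = semi_norm (@L2_dot _ _ _ mu) u.
Proof. by []. Qed.

End L2_dot_theory.

(** * Approximation and totality in L^2 over a finite measure *)

Section L2_finite_measure.
Context d (T : measurableType d) (R : realType) (mu : {measure set T -> \bar R}).
Implicit Types (f g : T -> R).
Local Notation Lf := (Lfun mu 2%:E).
Local Notation nm := (semi_norm (@L2_dot _ _ _ mu)).

Lemma Lfun2_sqr_integrable f : measurable_fun setT f ->
  mu.-integrable setT (fun x => (f x ^+ 2)%:E) -> f \in Lf.
Proof.
move=> mf /integrableP[_ fi]; rewrite inE; apply/andP; split; rewrite inE//=.
rewrite /finite_norm unlock /Lnorm poweR_lty//.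
apply: le_lt_trans fi; rewrite le_eqVlt; apply/orP; left; apply/eqP.
apply: eq_integral => x _ /=.
by rewrite -[2]/(2%:R) powR_mulrn// -normrX.
Qed.

Lemma Lfun2_le f g : measurable_fun setT f -> g \in Lf ->
  (forall x, `|f x| <= `|g x|) -> f \in Lf.
Proof.
move=> mf gL fg; apply: Lfun2_sqr_integrable => //.
apply: le_integrable (Lfun2_integrable_sqr gL) => //.
  by apply/measurable_EFinP; exact: measurable_funX.
by move=> x _ /=; rewrite lee_fin !normrX lerXn2r ?nnegrE.
Qed.

Lemma L2_dominated_approx (F : nat -> T -> R) f h : h \in Lf ->
  (forall n, measurable_fun setT (F n)) -> measurable_fun setT f ->
  (forall n x, `|F n x| <= h x) -> (forall x, F ^~ x @ \oo --> f x) ->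
  forall u : L2 mu, u = f %[ae mu] -> forall e : R, 0 < e ->
  exists n, forall v : L2 mu, v = F n %[ae mu] -> nm (u - v) < e.
Proof.
move=> hL mF mf Fh Ff u uf e e0.
(* The bound passes to the limit, so 2 h dominates each f - F n; its square is the integrable
   majorant for dominated convergence of the squared differences. *)
have fh x : `|f x| <= h x.
  have cn : (fun n => `|F n x|) @ \oo --> `|f x| by apply: cvg_norm; exact: Ff.
  rewrite -(cvg_lim (@Rhausdorff R) cn); apply: limr_le; first by apply/cvg_ex; exists `|f x|.
  by apply: nearW => n; exact: Fh.
have h2L : (fun x => 2 * h x) \in Lf.
  rewrite (_ : (fun x => 2 * h x) = fun x => 1 * h x + h x); first exact: Lfun2_lin.
  by apply/funext => x; rewrite mul1r mulr_natl mulr2n.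
have mB n : measurable_fun setT (fun x => f x - F n x) by apply: measurable_funB.
have Bh n x : `|f x - F n x| <= 2 * h x.
  by rewrite (le_trans (ler_normB _ _))// mulr_natl mulr2n lerD.
have BL n : (fun x => f x - F n x) \in Lf.
  apply: Lfun2_le (mB n) h2L _ => x; rewrite (le_trans (Bh n x))//; exact: ler_norm.
have cv : (\int[mu]_x ((f x - F n x) ^+ 2)%:E)%E @[n --> \oo] --> 0%E.
  have mB2 n : measurable_fun setT (fun x => ((f x - F n x) ^+ 2)%:E).
    by apply/measurable_EFinP; exact: measurable_funX.
  have [||_ _] := @dominated_convergence _ _ _ mu setT measurableT
    (fun n x => ((f x - F n x) ^+ 2)%:E) (cst 0%E) (fun x => ((2 * h x) ^+ 2)%:E)
    mB2 (measurable_cst _) _ (Lfun2_integrable_sqr h2L).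
  - apply: aeW => x _; apply: cvg_EFin; first exact: nearW.
    have B0 : (fun n => f x - F n x) @ \oo --> (0 : R).
      by rewrite -[X in _ --> X](subrr (f x)); apply: cvgB; [exact: cvg_cst|exact: Ff].
    rewrite (_ : fine \o _ = fun n => (f x - F n x) * (f x - F n x)); last first.
      by apply/funext => n; rewrite /= expr2.
    by rewrite -[X in _ --> X](mulr0 (0 : R)); exact: cvgM.
  - apply: aeW => x n _ /=; rewrite lee_fin ger0_norm ?sqr_ge0//.
    by rewrite -real_normK ?num_real// lerXn2r// ?nnegrE// (le_trans _ (Bh n x)).
  - by rewrite integral0.
have e20 : (0 < (e ^+ 2)%:E)%E by rewrite lte_fin exprn_gt0.
have : \forall n \near \oo, (\int[mu]_x ((f x - F n x) ^+ 2)%:E < (e ^+ 2)%:E)%E.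
  exact: (cv [set y | (y < (e ^+ 2)%:E)%E] (open_nbhs_nbhs (conj (@open_ereal_lt _ _) e20))).
move=> [n _ /(_ n (leqnn n))/= hn]; exists n => v vF.
have uv : (u - v : L2 mu) = (fun x => f x - F n x) %[ae mu].
  rewrite -[in u - v]scaleN1r.
  apply: filterS2 (filterI uf vF) (filterI (L2_addE u (-1 *: v)) (L2_scaleE (-1) v)).
  by move=> x [e1 e2] [e3 e4] xT; rewrite e3// e4// e1// e2// mulN1r.
rewrite /semi_norm (L2_dotE (BL n) (BL n) uv uv).
rewrite -(@ltr_pXn2r _ 2)// ?nnegrE ?sqrtr_ge0 ?ltW// sqr_sqrtr; last first.
  by apply: Rintegral_ge0 => x _; rewrite -expr2 sqr_ge0.
rewrite -lte_fin; apply: le_lt_trans hn.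
rewrite /Rintegral fineK; last exact: integrable_fin_num (Lfun2_mul_integrable (BL n) (BL n)).
by rewrite le_eqVlt; apply/orP; left; apply/eqP; apply: eq_integral => x _; rewrite expr2.
Qed.

Import HBSimple HBNNSimple.

Hypothesis mu_fin : (mu setT < +oo)%E.

Lemma Lfun2_bounded f C : measurable_fun setT f -> (forall x, `|f x| <= C) -> f \in Lf.
Proof.
move=> mf fC; apply: Lfun2_sqr_integrable => //.
apply: measurable_bounded_integrable => //; first exact: measurable_funX.
exists (C ^+ 2); split; rewrite ?num_real// => y Cy x _.
apply: le_trans (ltW Cy); rewrite /= ger0_norm ?sqr_ge0// -real_normK ?num_real//.
by rewrite lerXn2r// nnegrE (le_trans _ (fC x)).
Qed.

(* A closed subspace of L^2 containing the indicators of a generating pi-system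
   is everything: Dynkin's theorem, then approximation by simple functions. *)
Lemma L2_total (G : set (set T)) (V : set (L2 mu)) :
  @measurable _ T = <<s G >> -> setI_closed G -> G setT ->
  lin_subspace V ->
  (forall u, (forall e : R, 0 < e -> exists2 v, V v & nm (u - v) < e) -> V u) ->
  (forall A, G A -> exists2 u, V u & (u : T -> R) = \1_A %[ae mu]) ->
  forall u, V u.
Proof.
move=> GE GI GT Vs Vc VG.
(* [W] moves the question from classes to functions modulo null sets, where indicators and pointwise
   limits can be handled. *)
pose W f := exists2 u, V u & (u : T -> R) = f %[ae mu].
have Wlin a f g : W f -> W g -> W (fun x => a * f x + g x).
  move=> [u Vu uf] [v Vv vg]; exists (a *: u + v); first exact: (proj2 Vs).
  apply: filterS2 (filterI uf vg) (filterI (L2_addE (a *: u) v) (L2_scaleE a u)).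
  by move=> x [e1 e2] [e3 e4] xT; rewrite e3// e4// e1// e2.
have W0 : W (fun=> 0).
  exists 0; first exact: (proj1 Vs).
  rewrite -(scale0r (0 : L2 mu)); apply: filterS (L2_scaleE 0 0) => x h xT.
  by rewrite h// mul0r.
have Wlim (F : nat -> T -> R) f h : h \in Lf -> (forall n, measurable_fun setT (F n)) ->
    measurable_fun setT f -> (forall n x, `|F n x| <= h x) ->
    (forall x, F ^~ x @ \oo --> f x) -> (forall n, W (F n)) -> f \in Lf -> W f.
  move=> hL mF mf Fh Ff WF fL; exists (L2_of fL); last exact: L2_ofE.
  apply: Vc => e e0.
  have [n hn] := L2_dominated_approx hL mF mf Fh Ff (L2_ofE fL) e0.
  by have [v Vv vF] := WF n; exists v => //; exact: hn.
have L1 : (fun=> 1) \in Lf by apply: (@Lfun2_bounded _ 1) => // x; rewrite normr1.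
have Wind : forall A, measurable A -> W (\1_A : T -> R).
  pose H := [set A | measurable A /\ W (\1_A : T -> R)].
  suff : <<s G >> `<=` H by rewrite -GE => h A /h[].
  have mG : G `<=` @measurable _ T by rewrite GE; exact: sub_sigma_algebra.
  apply: (@lambda_system_subset _ G GI setT) => //; last first.
    by move=> B GB; split; [exact: mG|exact: VG].
  split=> //.
  - by split => //; exact: VG.
  - move=> A B BA [mA WA] [mB WB]; split; first exact: measurableD.
    have := Wlin (-1) _ _ WB WA; congr W; apply/funext => x.
    rewrite !indicE in_setD; have [xB|xB] := boolP (x \in B).
      by rewrite (mem_set (BA _ (set_mem xB))) mulr1 addNr.
    by rewrite mulr0 add0r andbT.
  - move=> A ndA HA; have mU : measurable (\bigcup_n A n).
      by apply: bigcupT_measurable => n; have [] := HA n.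
    split=> //.
    apply: (Wlim (fun n => \1_(A n)) _ (fun=> 1)) => //.
    + by move=> n; apply: measurable_indic; have [] := HA n.
    + by move=> n x; rewrite indicE ger0_norm ?ler0n// lern1 leq_b1.
    (* The sets increase, so at a fixed point their indicators are eventually constant. *)
    + move=> x; apply: cvg_near_cst.
      have [[n _ Anx]|nU] := pselect ((\bigcup_n A n) x).
        near=> k; rewrite !indicE !mem_set//; first by exists n.
        have /subsetPset AA : (A n <= A k)%O by apply: ndA; near: k; exact: nbhs_infty_ge.
        exact: AA Anx.
      by apply: nearW => k; rewrite !indicE !memNset// => Akx; apply: nU; exists k.
    + by move=> n; have [] := HA n.
    + apply: (@Lfun2_bounded _ 1) => // x.
      by rewrite indicE ger0_norm ?ler0n// lern1 leq_b1.
have Wnn (f : {nnsfun T >-> R}) : W f.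
  rewrite (_ : (f : T -> R) = fun x => \sum_(y <- finmap.enum_fset (fset_set (range f))) (y * \1_(f @^-1` [set y]) x)).
    elim: (finmap.enum_fset _) => [|y s IH].
      by under eq_fun do rewrite big_nil.
    under eq_fun do rewrite big_cons.
    by apply: Wlin => //; apply: Wind; exact: measurable_sfunP.
  by apply/funext => x; rewrite fimfunE fsbig_finite.
have Wge0 f : f \in Lf -> (forall x, 0 <= f x) -> W f.
  move=> fL f0; have mf := Lfun2_measurable fL.
  have mEf : measurable_fun setT (EFin \o f) by exact/measurable_EFinP.
  have f0' x : [set: T] x -> (0 <= (EFin \o f) x)%E by rewrite /= lee_fin.
  apply: (Wlim (fun n => nnsfun_approx measurableT mEf n) _ f) => //.
  - move=> n x; rewrite ger0_norm// nnsfun_approxE -lee_fin.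
    exact: (le_approx n f0').
  - move=> x; have := cvg_nnsfun_approx measurableT mEf f0' (I : [set: T] x).
    by move=> /fine_cvgP[].
move=> u; have uL := L2_Lfun u; have mu_ := Lfun2_measurable uL.
(* Monotone approximation by simple functions handles nonnegative functions; a general one is the
   difference of its positive and negative parts. *)
have uE : W (fun x => -1 * Num.max (- u x) 0 + Num.max (u x) 0).
  apply: Wlin; apply: Wge0 => [|x]; rewrite ?le_max ?lexx ?orbT//.
    apply: Lfun2_le _ uL _ => [|x]; first exact: measurable_funrneg mu_.
    by rewrite maxEle; case: ifPn; rewrite ?normr0 ?normrN.
  apply: Lfun2_le _ uL _ => [|x]; first exact: measurable_funrpos mu_.
  by rewrite maxEle; case: ifPn; rewrite ?normr0.
have [v Vv vu] := uE; rewrite (_ : u = v)//; apply: L2_eq.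
apply: filterS vu => x vu xT; rewrite vu// mulN1r.
have [u0|u0] := leP 0 (u x).
  have u0' : - u x <= 0 by rewrite oppr_le0.
  by rewrite (max_r u0') oppr0 add0r.
have u0' : 0 <= - u x by rewrite oppr_ge0 ltW.
by rewrite (max_l u0') opprK addr0.
Unshelve. all: by end_near. Qed.

End L2_finite_measure.

(** * Integration by parts and smooth cutoffs on R^d *)

(** A directional derivative sees only the restriction to a line. This transfers derivatives between
    a function, its slices in lower dimension and one-variable functions. *)
Lemma eq_directional (R : realType) (V V' : normedModType R) (f : V -> R) (g : V' -> R)
    x x' v v' : (forall h : R, f (h *: v + x) = g (h *: v' + x')) ->
  (derivable f x v <-> derivable g x' v') /\ 'D_v f x = 'D_v' g x'.
Proof.
move=> fg; have fgx : f x = g x' by have := fg 0; rewrite !scale0r !add0r.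
rewrite /derivable /derive (_ : (fun h => _) =
  (fun h => h^-1 *: ((g \o shift x') (h *: v') - g x')))//.
by apply/funext => h /=; rewrite fg fgx.
Qed.

(** * Fubini on row vectors and the integral of a partial derivative *)

Section lebesgue_row_integral.
Variable R : realType.

Definition cube n (M : R) : set 'rV[R]_n := [set x | forall i, x ord0 i \in `[- M, M]].

Lemma compact_cube n M : compact (@cube n M).
Proof.
by apply: (@rV_compact _ _ (fun=> `[- M, M]%classic)) => _; exact: segment_compact.
Qed.

Lemma closed_cube n M : closed (@cube n M).
Proof. by apply: compact_closed; [exact: norm_hausdorff|exact: compact_cube]. Qed.

Lemma measurable_cube n M : measurable (@cube n M).
Proof.
rewrite -[cube M]setCK; apply: measurableC; apply: open_measurable_mx.
by apply: closed_openC; exact: closed_cube.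
Qed.

Lemma lebesgue_row_cube n M : (@lebesgue_row R n (@cube n M) < +oo)%E.
Proof.
elim: n => [|n IH].
  by rewrite /= /dirac/= indicE; case: (_ \in _); rewrite ltry.
rewrite /= /pushforward (_ : _ @^-1` _ = `[- M, M]%classic `*` @cube n M).
  rewrite product_measure1E//; last exact: measurable_cube.
  rewrite lte_mul_pinfty//; first by rewrite ge0_fin_numE// compact_finite_measure//; exact: segment_compact.
apply/seteqP; split => -[a v]/=.
  move=> h; split; first by have := h ord0; rewrite cons_rowE0.
  by move=> i; have := h (lift ord0 i); rewrite cons_rowES.
move=> [ha hv] i; case: (unliftP ord0 i) => [j ->|->].
  by rewrite cons_rowES; exact: hv.
by rewrite cons_rowE0.
Qed.

Lemma integrable_continuous_cube n M (g : 'rV[R]_n -> R) : continuous g ->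
  (forall x, ~ cube M x -> g x = 0) ->
  (@lebesgue_row R n).-integrable setT (EFin \o g).
Proof.
move=> cg g0.
have mg : measurable_fun setT g by exact: continuous_measurable_mx.
rewrite (_ : EFin \o g = (EFin \o g) \_ (cube M)); last first.
  apply/funext => x; rewrite patchE; case: ifPn => // /negP xM /=.
  by rewrite g0// => h; apply: xM; exact: mem_set.
apply/(integrable_mkcond _ (@measurable_cube n M)).
apply: measurable_bounded_integrable.
- exact: measurable_cube.
- exact: lebesgue_row_cube.
- exact: measurable_funTS.
- have cgw : {within cube M, continuous g} by exact: continuous_subspaceT.
  have /compact_bounded[N [_ hN]] := continuous_compact cgw (@compact_cube n M).
  by exists N; split; rewrite ?num_real// => y Ny x xM; apply: hN => //; exists x.
Qed.

Definition prod_lebesgue_row n :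
  {measure set (measurableTypeR R * 'rV[R]_n)%type -> \bar R} :=
  (@lebesgue_measure R \x @lebesgue_row R n)%E.

Lemma measurable_cons_rowR n :
  measurable_fun [set: (measurableTypeR R * 'rV[R]_n)%type] (@cons_row R n).
Proof. exact: measurable_cons_row. Qed.

Lemma integrable_cons_row n (f : 'rV[R]_n.+1 -> \bar R) :
  (@lebesgue_row R n.+1).-integrable setT f ->
  (prod_lebesgue_row n).-integrable setT (f \o @cons_row R n).
Proof.
move=> /integrableP[mf fi]; apply/integrableP; split.
  by apply: measurableT_comp => //; exact: measurable_cons_rowR.
apply: le_lt_trans fi.
have := @ge0_integral_pushforward _ _ _ _ _ _ (@measurable_cons_rowR n)
  (prod_lebesgue_row n) setT (fun x => `|f x|%E) measurableT.
rewrite preimage_setT => ->//.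
exact: measurableT_comp.
Qed.

(** [lebesgue_row] is by definition the image of this product measure, so a change of variables
    makes Fubini's theorem applicable. *)
Lemma integral_cons_row n (f : 'rV[R]_n.+1 -> \bar R) :
  (@lebesgue_row R n.+1).-integrable setT f ->
  (\int[@lebesgue_row R n.+1]_x f x =
   \int[prod_lebesgue_row n]_z f (cons_row z))%E.
Proof.
move=> fi.
have := @integral_pushforward _ _ _ _ _ _ (@measurable_cons_rowR n)
  (prod_lebesgue_row n) setT f (measurable_int _ fi).
by rewrite preimage_setT => -> //; exact: integrable_cons_row.
Qed.

Lemma continuous_cons_row n (z : R * 'rV[R]_n) :
  (forall e, 0 < e -> forall w : R * 'rV[R]_n, `|z.1 - w.1| < e -> ball z.2 e w.2 ->
    ball (cons_row z) e (cons_row w)).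
Proof.
move=> e e0 w h1 [_ h2]; split => // i j; rewrite ord1.
case: (unliftP ord0 j) => [k ->|->].
  by rewrite !cons_rowES; exact: h2.
by rewrite !cons_rowE0.
Qed.

Lemma continuous_cons_row_r n (a : R) : continuous (fun v : 'rV[R]_n => cons_row (a, v)).
Proof.
move=> v A /nbhs_ballP[e /= e0 eA]; apply/nbhs_ballP; exists e => // w vw.
by apply: eA; apply: continuous_cons_row => //=; rewrite subrr normr0.
Qed.

Lemma continuous_cons_row_l n (v : 'rV[R]_n) : continuous (fun a : R => cons_row (a, v)).
Proof.
move=> a A /nbhs_ballP[e /= e0 eA]; apply/nbhs_ballP; exists e => // b ab.
by apply: eA; apply: continuous_cons_row => //=; exact: ballxx.
Qed.

Lemma cons_row_shift0 n h a (v : 'rV[R]_n) :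
  cons_row (h + a, v) = h *: delta_mx ord0 ord0 + cons_row (a, v).
Proof.
apply/rowP => i; rewrite [RHS]mxE; case: (unliftP ord0 i) => [k ->|->].
  by rewrite !cons_rowES/= !mxE/= mulr0 add0r.
by rewrite !cons_rowE0/= !mxE/= mulr1.
Qed.

Lemma cons_row_shiftS n h a j (v : 'rV[R]_n) :
  cons_row (a, h *: delta_mx ord0 j + v) =
  h *: delta_mx ord0 (lift ord0 j) + cons_row (a, v).
Proof.
apply/rowP => i; rewrite [RHS]mxE; case: (unliftP ord0 i) => [k ->|->].
  by rewrite !cons_rowES/= !mxE/= (inj_eq lift_inj).
by rewrite !cons_rowE0/= !mxE/= mulr0 add0r.
Qed.

Lemma partial_eq0 n (i : 'I_n) (f : 'rV[R]_n -> R) (A : set 'rV[R]_n) x :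
  open A -> (forall y, A y -> f y = 0) -> A x -> partial i f x = 0.
Proof.
move=> oA f0 Ax; transitivity ('D_(delta_mx ord0 i) (cst 0 : 'rV[R]_n -> R) x); last exact: derive_cst.
apply: near_eq_derive.
by have : nbhs x A := open_nbhs_nbhs (conj oA Ax); apply: filterS => y /f0.
Qed.

Lemma integral_partial0 n (i : 'I_n) (f : 'rV[R]_n -> R) M : class_C 1 f ->
  (forall x, ~ cube M x -> f x = 0) ->
  (\int[@lebesgue_row R n]_x (partial i f x)%:E = 0)%E.
Proof.
elim: n => [|n IH] in i f *; first by case: i.
move=> [cf /all_and2[df cpf]] f0.
have cp j := (cpf j).1.
have p0 j x : ~ cube M x -> partial j f x = 0.
  apply: (@partial_eq0 _ j f (~` cube M)); last exact: f0.
  exact/closed_openC/closed_cube.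
have ip j : (@lebesgue_row R n.+1).-integrable setT (EFin \o partial j f).
  exact: integrable_continuous_cube (cp j) (p0 j).
rewrite integral_cons_row//; last exact: ip.
have icp j := integrable_cons_row (ip j).
case: (unliftP ord0 i) => [j ->|->].
(* A later coordinate: freeze the first one and apply the induction hypothesis to the slice, which
   is again C^1 and vanishes off the smaller cube. *)
- rewrite -(integral12_prod_meas1 (icp _)) /fubini_F integral0_eq// => a _.
  rewrite -[RHS](IH j (fun v => f (cons_row (a, v)))).
  + apply: eq_integral => v _ /=; congr EFin; apply: (eq_directional _).2 => h.
    by rewrite cons_row_shiftS.
  + split=> [v|k].
      by apply: (continuous_comp (@continuous_cons_row_r _ _ v)); exact: cf.
    have e v := @eq_directional _ _ _ (fun v => f (cons_row (a, v))) f v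
      (cons_row (a, v)) _ _ (fun h => congr1 f (cons_row_shiftS h a k v)).
    split => [v|]; first by apply/(e v).1; exact: df.
    split=> //.
    rewrite (_ : partial _ _ = (fun v => partial (lift ord0 k) f (cons_row (a, v)))).
      move=> v.
      by apply: (continuous_comp (@continuous_cons_row_r _ _ v)); exact: cp.
    by apply/funext => v; exact: (e v).2.
  + move=> v vM; apply: f0 => h; apply: vM => k.
    by have := h (lift ord0 k); rewrite cons_rowES.
(* The first coordinate: freeze all the others and apply the fundamental theorem on a line. *)
- rewrite -(integral21_prod_meas1 (icp _)) /fubini_G integral0_eq// => v _ /=.
  pose F a := f (cons_row (a, v)); pose G a := partial ord0 f (cons_row (a, v)).
  have dF (a : R) : is_derive a 1 F (G a).
    have e : forall h, F (h *: 1 + a) = f (h *: delta_mx ord0 ord0 + cons_row (a, v)).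
      by move=> h; rewrite /F -cons_row_shift0 [h *: 1]mulr1.
    have [de eD] := eq_directional e.
    by apply: DeriveDef; [exact/de/df|exact: eD].
  have cF : continuous F.
    by move=> a; apply: (continuous_comp (@continuous_cons_row_l _ v a)); exact: cf.
  have cG : continuous G.
    by move=> a; apply: (continuous_comp (@continuous_cons_row_l _ v a)); exact: cp.
  (* M may be negative. With N above |M|, the interval is nondegenerate and its endpoints lie
     outside the cube, where F vanishes. *)
  pose N : R := `|M| + 1.
  have MN : `|M| < N by rewrite ltrDl.
  have N0 : 0 < N by rewrite (le_lt_trans _ MN).
  have out (a : R) : M < `|a| -> ~ cube M (cons_row (a, v)).
    by move=> aM /(_ ord0); rewrite cons_rowE0/= in_itv/= -ler_norml leNgt aM.
  transitivity (\int[@lebesgue_measure R]_(a in `[(- N)%R, N]%classic) (G a)%:E)%E.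
    rewrite [RHS]integral_mkcond; apply: eq_integral => a _.
    rewrite patchE; case: ifPn => // /negP aN; rewrite p0//; apply: out.
    rewrite (le_lt_trans (ler_norm _))// (lt_trans MN)//.
    by rewrite ltNge; apply/negP => h; apply: aN; apply/mem_set; rewrite /= in_itv/= -ler_norml.
  rewrite (@continuous_FTC2 _ G F).
  + have F0 b : M < `|b| -> F b = 0 by move=> Mb; rewrite /F f0//; exact: out.
    by rewrite !F0 ?subee// ?normrN gtr0_norm// (le_lt_trans (ler_norm _)).
  + by rewrite gtrN.
  + exact: continuous_subspaceT.
  + split => [a _||].
    * exact: (@ex_derive _ _ _ _ _ _ _ (dF a)).
    * exact: cvg_at_right_filter (cF _).
    * exact: cvg_at_left_filter (cF _).
  + by move=> a _; rewrite derive1E; exact: (@derive_val _ _ _ _ _ _ _ (dF a)).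
Qed.

End lebesgue_row_integral.

Section smooth_functions.
Context {R : realType} {d : nat}.
Implicit Types (f g : 'rV[R]_d -> R).

Lemma class_C_continuous k f : class_C k f -> continuous f.
Proof. by case: k => [[]|k []]. Qed.

Lemma class_CS k f : class_C k.+1 f -> class_C k f.
Proof.
elim: k => [|k IH] in f *; first by case.
move=> [cf h]; split => // i; have [df cp] := h i; split => //.
exact: IH cp.
Qed.

Lemma class_C_cst k (a : R) : class_C k (fun _ : 'rV[R]_d => a).
Proof.
elim: k a => [|k IH] a; split=> //; try exact: cst_continuous.
move=> i; split => [x|]; first exact: derivable_cst.
rewrite (_ : partial i _ = fun _ => 0) //.
by apply/funext => x; exact: derive_cst.
Qed.

Lemma class_CD k f g : class_C k f -> class_C k g -> class_C k (fun x => f x + g x).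
Proof.
elim: k => [|k IH] in f g *; move=> [cf hf] [cg hg]; split => //;
  try by move=> x; exact: (cvgD (cf x) (cg x)).
move=> i; have [df cpf] := hf i; have [dg cpg] := hg i.
split => [x|]; first exact: derivableD.
rewrite (_ : partial i _ = fun x => partial i f x + partial i g x).  exact: IH.
by apply/funext => x; exact: deriveD.
Qed.

Lemma class_CM k f g : class_C k f -> class_C k g -> class_C k (fun x => f x * g x).
Proof.
elim: k => [|k IH] in f g *; move=> Cf Cg; move: (Cf) (Cg) => [cf hf] [cg hg];
  split => //; try by move=> x; exact: (cvgM (cf x) (cg x)).
move=> i; have [df cpf] := hf i; have [dg cpg] := hg i.
split => [x|]; first exact: derivableM.
rewrite (_ : partial i _ = fun x => f x * partial i g x + g x * partial i f x).
  by apply: class_CD; apply: IH => //; exact: class_CS.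
by apply/funext => x; exact: deriveM.
Qed.

Lemma class_CZ k a f : class_C k f -> class_C k (fun x => a * f x).
Proof. by apply: class_CM; exact: class_C_cst. Qed.

Lemma class_C_prod k (I : Type) (s : seq I) (F : I -> 'rV[R]_d -> R) :
  (forall i, class_C k (F i)) -> class_C k (fun x => \prod_(i <- s) F i x).
Proof.
move=> hF; elim: s => [|i s IH].
  by under eq_fun do rewrite big_nil; exact: class_C_cst.
by under eq_fun do rewrite big_cons; exact: class_CM.
Qed.

End smooth_functions.

(** * A smooth function of one variable vanishing on a half-line *)

Section flat_function.
Variable R : realType.
Implicit Types (t : R) (n : nat).

(* The family t^-n exp(-1/t) is, up to linear combinations, stable under
   differentiation, and all its members vanish to infinite order at 0. *)
Definition flat n t : R := if 0 < t then t^-1 ^+ n * expR (- t^-1) else 0.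

Lemma flat_ge0 n t : 0 <= flat n t.
Proof.
by rewrite /flat; case: ifPn => // /ltW t0; rewrite mulr_ge0 ?expR_ge0// exprn_ge0 ?invr_ge0.
Qed.

Lemma flat0_gt0 t : 0 < t -> 0 < flat 0 t.
Proof. by move=> t0; rewrite /flat t0 expr0 mul1r expR_gt0. Qed.

Lemma flat_eq0 n t : t <= 0 -> flat n t = 0.
Proof. by rewrite /flat ltNge => ->. Qed.

Lemma flat0_le1 t : flat 0 t <= 1.
Proof.
rewrite /flat; case: ifPn => // t0.
by rewrite expr0 mul1r expR_le1 oppr_le0 invr_ge0 ltW.
Qed.

(** With y = 1/t this is y^n / n! <= exp y, one term of the exponential series. *)
Lemma flat_bounded n t : flat n t <= n`!%:R.
Proof.
rewrite /flat; case: ifPn => [t0|_]; last exact: ler0n.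
have y0 : 0 <= t^-1 by rewrite invr_ge0 ltW.
rewrite expRN ler_pdivrMr ?expR_gt0//.
case: n => [|n].
  by rewrite expr0 fact0 mul1r (le_trans _ (expR_ge1Dx _))// lerDl.
have := expR_ge1Dxn n y0; set F := n.+1`!%:R.
have F0 : 0 < F by rewrite ltr0n fact_gt0.
move=> h; rewrite -ler_pdivrMl// mulrC; apply: le_trans h.
by rewrite lerDr.
Qed.

(** Together with [flat_bounded] this gives flat n t <= (n+2)! t^2, so the derivative at 0 exists
    and is 0. *)
Lemma flat_shift n t : 0 <= t -> flat n t = t ^+ 2 * flat n.+2 t.
Proof.
rewrite le_eqVlt => /predU1P[<-|t0]; first by rewrite !flat_eq0// mulr0.
rewrite /flat t0 !exprS; field; exact: lt0r_neq0.
Qed.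

Lemma is_derive_flat n t :
  is_derive t 1 (flat n) (flat n.+2 t - n%:R * flat n.+1 t).
Proof.
have [t0|t0|->] := ltgtP t 0.
- rewrite !flat_eq0 ?ltW// mulr0 subr0.
  apply: (@near_eq_is_derive _ _ _ (cst 0)).
  near=> s; rewrite flat_eq0// ltW//.
  by near: s; exact: open_nbhs_nbhs (conj (@open_lt R 0) t0).
- apply: (@near_eq_is_derive _ _ _ (fun s : R => s^-1 ^+ n * expR (- s^-1))).
    near=> s; rewrite /flat ifT//.
    by near: s; exact: open_nbhs_nbhs (conj (@open_gt R 0) t0).
  rewrite /flat t0.
  have tn0 : t != 0 by rewrite gt_eqF.
  have dV : is_derive t 1 (fun s : R => s^-1) (- (t^-1 ^+ 2)).
    apply: DeriveDef; first by apply: derivableV.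
    by rewrite deriveV// derive_id scaler1 exprVn.
  have dN : is_derive t 1 (fun s : R => - s^-1) (t^-1 ^+ 2).
    by have := is_deriveN dV; rewrite opprK.
  have dE := @is_derive1_comp R expR (fun s => - s^-1) t _ _ (is_derive_expR _) dN.
  have dX := is_deriveX n dV.
  rewrite exprfctE in dX.
  have dM := is_deriveM dX dE.
  apply: (is_derive_eq dM).
  rewrite /GRing.scale/= !exprS; case: n {dX dM} => [|n]/=; rewrite ?expr0 ?exprS; ring.
- rewrite !flat_eq0// mulr0 subr0.
  suff cv : (fun h : R => h^-1 *: (flat n (h *: 1 + 0) - flat n 0)) @ 0^' --> 0.
    by apply: DeriveDef; [apply/cvg_ex; exists 0|exact/cvg_lim].
  apply/cvgrPdist_lt => e e0; near=> h.
  rewrite sub0r normrN [h *: 1]mulr1 addr0 (flat_eq0 _ (lexx 0)) subr0.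
  have [h0|h0] := leP h 0; first by rewrite flat_eq0// scaler0 normr0.
  rewrite flat_shift ?ltW// /GRing.scale/= expr2 mulrA mulKf ?gt_eqF//.
  rewrite ger0_norm ?mulr_ge0 ?flat_ge0 ?ltW//.
  have F0 : 0 < (n.+2)`!%:R :> R by rewrite ltr0n fact_gt0.
  rewrite (@le_lt_trans _ _ (h * (n.+2)`!%:R))//.
    by rewrite ler_wpM2l ?flat_bounded// ltW.
  rewrite -ltr_pdivlMr// -[h]gtr0_norm//.
  by near: h; apply: dnbhs0_lt; rewrite divr_gt0.
Unshelve. all: by end_near. Qed.

Lemma derive_direction (f : R -> R) t v l : is_derive t 1 f l ->
  is_derive t v f (v * l).
Proof.
move=> [df dl]; have /derivable1_diffP ff := df.
apply: DeriveDef; first exact: diff_derivable.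
have -> : v * l = v *: 'd f t (1 : R) by rewrite -deriveE// dl.
by rewrite -linearZ [v *: _]mulr1 deriveE.
Qed.

Lemma continuous_flat n : continuous (flat n).
Proof.
move=> t; apply/differentiable_continuous/derivable1_diffP.
exact: (@ex_derive _ _ _ _ _ _ _ (is_derive_flat n t)).
Qed.

(** The induction on k leaves n free because differentiation raises the index by one and by two.
    Along axis j the argument has slope c if i = j and 0 otherwise, which is the factor [b]. *)
Lemma class_C_flat d k n (c e : R) (i : 'I_d) :
  class_C k (fun x : 'rV[R]_d => flat n (c * x ord0 i + e)).
Proof.
have ca : continuous (fun x : 'rV[R]_d => c * x ord0 i + e).
  move=> x; exact: (cvgD (cvgM (cvg_cst c) (@coord_continuous _ _ _ ord0 i x)) (cvg_cst e)).
elim: k n => [|k IH] n; split=> //;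
  try by move=> x; exact: (continuous_comp (ca x) (@continuous_flat n _)).
move=> j; pose b : R := (i == j)%:R * c.
have e1 (x : 'rV[R]_d) (h : R) : flat n (c * (h *: delta_mx ord0 j + x) ord0 i + e) =
    flat n (h *: b + (c * x ord0 i + e)).
  by congr flat; rewrite !mxE eqxx/= /b /GRing.scale/=; ring.
have dd x := @eq_directional _ _ _ (fun x : 'rV[R]_d => flat n (c * x ord0 i + e)) _ _ _ _ _ (e1 x).
have df (x : 'rV[R]_d) := derive_direction b (is_derive_flat n (c * x ord0 i + e)).
split => [x|].
  by apply/(dd x).1; exact: (@ex_derive _ _ _ _ _ _ _ (df x)).
rewrite (_ : partial j _ = fun x => b * (flat n.+2 (c * x ord0 i + e) +
    (- n%:R) * flat n.+1 (c * x ord0 i + e))).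
  by apply: class_CZ; apply: class_CD => //; exact: class_CZ.
apply/funext => x; rewrite /partial (dd x).2 (@derive_val _ _ _ _ _ _ _ (df x)).
by rewrite mulNr.
Qed.

End flat_function.

(** * Test functions and smooth cutoffs *)

Section test_functions.
Context {R : realType} {d : nat}.
Implicit Types (Om O A : set 'rV[R]_d) (f g : 'rV[R]_d -> R).

(** Any compact set off which f vanishes can stand for the support, so closures need not be computed
    again. *)
Lemma test_function_sub Om A f : (forall k, class_C k f) -> compact A -> A `<=` Om ->
  (forall x, ~ A x -> f x = 0) -> test_function Om f.
Proof.
move=> Cf cA AO f0.
have sA : closure [set x | f x != 0] `<=` A.
  have /closure_id -> : closed A by apply: compact_closed => //; exact: norm_hausdorff.
  by apply: closureS => x /= /eqP fx; apply: contrapT => /f0.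
split=> //; last exact: subset_trans AO.
by apply: subclosed_compact sA => //; exact: closed_closure.
Qed.

Lemma test_function_smooth Om k f : test_function Om f -> class_C k f.
Proof. by case. Qed.

Lemma test_function_supp Om f : test_function Om f ->
  exists2 A, compact A & A `<=` Om /\ forall x, ~ A x -> f x = 0.
Proof.
move=> [_ cf fO]; exists (closure [set x | f x != 0]) => //; split => // x nx.
by apply/eqP; apply: contra_notT nx => fx0; exact: subset_closure.
Qed.

Lemma test_function_subset Om O f : O `<=` Om -> test_function O f -> test_function Om f.
Proof. by move=> OOm [Cf cf fO]; split => //; exact: subset_trans OOm. Qed.

Lemma test_function0 Om : test_function Om (fun=> 0).
Proof.
by apply: (@test_function_sub _ set0) => //; [move=> k; exact: class_C_cst|exact: compact0].
Qed.

Lemma test_functionD Om f g : test_function Om f -> test_function Om g ->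
  test_function Om (fun x => f x + g x).
Proof.
move=> tf tg; have [A cA [AO fA]] := test_function_supp tf.
have [B cB [BO gB]] := test_function_supp tg.
apply: (@test_function_sub _ (A `|` B)).
- by move=> k; apply: class_CD; apply: test_function_smooth; eassumption.
- exact: compactU.
- by rewrite subUset.
- by move=> x /not_orP[nA nB]; rewrite fA// gB// addr0.
Qed.

Lemma test_functionMr Om f g : test_function Om f -> (forall k, class_C k g) ->
  test_function Om (fun x => f x * g x).
Proof.
move=> tf Cg; have [A cA [AO fA]] := test_function_supp tf.
apply: (@test_function_sub _ A) => //.
- by move=> k; apply: class_CM => //; apply: test_function_smooth; eassumption.
- by move=> x /fA ->; rewrite mul0r.
Qed.

Lemma test_functionZ Om a f : test_function Om f -> test_function Om (fun x => a * f x).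
Proof.
move=> tf; under eq_fun do rewrite mulrC.
by apply: test_functionMr => // k; exact: class_C_cst.
Qed.

Lemma test_function_partial Om i f : test_function Om f -> test_function Om (partial i f).
Proof.
move=> tf; have [A cA [AO fA]] := test_function_supp tf.
apply: (@test_function_sub _ A) => //.
- by move=> k; have [_ /(_ i)[]] := test_function_smooth k.+1 tf.
- move=> x; apply: (@partial_eq0 _ _ _ _ (~` A)); last exact: fA.
  by apply: closed_openC; apply: compact_closed => //; exact: norm_hausdorff.
Qed.

Lemma test_functionB Om f g : test_function Om f -> test_function Om g ->
  test_function Om (fun x => f x - g x).
Proof.
move=> tf tg; rewrite (_ : (fun _ => _) = fun x => f x + -1 * g x).
  by apply: test_functionD => //; exact: test_functionZ.
by apply/funext => x; rewrite mulN1r.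
Qed.

Definition cutoff O f := test_function O f /\ forall x, 0 <= f x <= 1.

Lemma cutoff0 O : cutoff O (fun=> 0).
Proof. by split=> [|x]; [exact: test_function0|rewrite lexx ler01]. Qed.

(** A smooth substitute for the maximum: it vanishes where both functions do and is at least each of
    them. *)
Lemma cutoff_or O f g : cutoff O f -> cutoff O g ->
  cutoff O (fun x => 1 - (1 - f x) * (1 - g x)).
Proof.
move=> [tf f01] [tg g01]; split.
  rewrite (_ : (fun _ => _) = fun x => f x + (g x - g x * f x)).
    apply: test_functionD => //; apply: test_functionB => //.
    by apply: test_functionMr => // k; exact: test_function_smooth tf.
  by apply/funext => x; ring.
by move=> x; move: (f01 x) (g01 x) => /andP[? ?] /andP[? ?]; apply/andP; split; nra.
Qed.

(** Amplification: as n grows this tends to 1 wherever f is positive and stays 0 wherever f is 0. *)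
Lemma cutoff_expn O f n : cutoff O f -> cutoff O (fun x => 1 - (1 - f x) ^+ n).
Proof.
move=> cf; elim: n => [|n IH].
  by under eq_fun do rewrite expr0 subrr; exact: cutoff0.
have := cutoff_or cf IH; congr cutoff; apply/funext => x.
by rewrite exprS; ring.
Qed.

Lemma cutoff_prod O (I : Type) (s : seq I) (F : I -> 'rV[R]_d -> R) :
  (forall i, cutoff O (F i)) -> cutoff O (fun x => 1 - \prod_(i <- s) (1 - F i x)).
Proof.
move=> cF; elim: s => [|i s IH].
  by under eq_fun do rewrite big_nil subrr; exact: cutoff0.
have := cutoff_or (cF i) IH; congr cutoff; apply/funext => x.
by rewrite big_cons; ring.
Qed.

Definition cube_around (a : 'rV[R]_d) (e : R) :=
  [set x : 'rV[R]_d | forall i, x ord0 i \in `[a ord0 i - e, a ord0 i + e]].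

Lemma compact_cube_around a e : compact (cube_around a e).
Proof.
apply: (@rV_compact _ _ (fun i => `[a ord0 i - e, a ord0 i + e]%classic)) => i.
exact: segment_compact.
Qed.

(** Each factor is positive exactly when the i-th coordinate lies strictly within e of that of a.
    The coefficients 1 and -1 are written out to match the affine form in [class_C_flat]. *)
Definition bump (a : 'rV[R]_d) (e : R) (x : 'rV[R]_d) : R :=
  \prod_(i < d) (flat 0 (1 * x ord0 i + (e - a ord0 i)) *
                 flat 0 (-1 * x ord0 i + (a ord0 i + e))).

Lemma cutoff_bump O a e : cube_around a e `<=` O -> cutoff O (bump a e).
Proof.
move=> aO; split; last first.
  move=> x; apply/andP; split.
    by apply: prodr_ge0 => i _; rewrite mulr_ge0 ?flat_ge0.
  by apply: Num.Theory.prodr_ile1 => i _; rewrite mulr_ge0 ?flat_ge0// mulr_ile1 ?flat_ge0 ?flat0_le1.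
apply: (@test_function_sub _ (cube_around a e)) => //.
- by move=> k; apply: class_C_prod => i; apply: class_CM; exact: class_C_flat.
- exact: compact_cube_around.
- move=> x /existsNP[i /negP]; rewrite in_itv/= negb_and -!ltNge => xi.
  rewrite /bump (bigD1 i)//=; case/orP: xi => xi.
    by rewrite flat_eq0 ?mul0r//; lra.
  by rewrite [X in _ * X * _]flat_eq0 ?mulr0 ?mul0r//; lra.
Qed.

Lemma bump_gt0 (a : 'rV[R]_d) e (x : 'rV[R]_d) : (forall i, `|x ord0 i - a ord0 i| < e) -> 0 < bump a e x.
Proof.
move=> xa; apply: prodr_gt0 => i _; have := xa i; rewrite ltr_norml => /andP[h1 h2].
by apply: mulr_gt0; apply: flat0_gt0; lra.
Qed.

Lemma open_cutoff_cover O : open O -> exists F : nat -> 'rV[R]_d -> R,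
  (forall k, cutoff O (F k)) /\ forall x, O x -> exists k, 0 < F k x.
Proof.
move=> oO.
pose P (q : 'rV[rat]_d * nat) :=
  `[< cube_around (map_mx ratr q.1) q.2.+1%:R^-1 `<=` O >].
(* An enumeration of the bumps on rational cubes contained in O, with the zero cutoff for every
   other index. *)
pose F k := if unpickle k is Some q then
  if P q then bump (map_mx ratr q.1) q.2.+1%:R^-1 else fun=> 0 else fun=> 0.
exists F; split=> [k|x Ox].
  rewrite /F; case: unpickle => [q|]; last exact: cutoff0.
  by case: ifPn => [/asboolP|_]; [exact: cutoff_bump|exact: cutoff0].
have /nbhs_ballP[e /= e0 eO] := open_nbhs_nbhs (conj oO Ox).
have e20 : 0 < e / 2 by rewrite divr_gt0.
(* With radius 1/(k+1) < e/2 and a rational centre closer to x than this radius, the closed cube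
   stays in the ball of radius e around x. *)
pose k := Num.trunc (e / 2)^-1.
have ke : k.+1%:R^-1 < e / 2 by rewrite invf_plt ?posrE// truncnS_gt.
have kp : 0 < k.+1%:R^-1 :> R by rewrite invr_gt0.
have hq i : {q : rat | `|x ord0 i - ratr q| < k.+1%:R^-1}.
  apply: cid; have [|q] := @rat_in_itvoo R (x ord0 i) (x ord0 i + k.+1%:R^-1).
    by rewrite ltrDl.
  rewrite in_itv/= => /andP[q1 q2]; exists q.
  by rewrite distrC gtr0_norm ?subr_gt0// ltrBlDl.
pose q : 'rV[rat]_d := \row_i sval (hq i).
have qE i : (map_mx ratr q : 'rV[R]_d) ord0 i = ratr (sval (hq i)) by rewrite !mxE.
exists (pickle (q, k)); rewrite /F pickleK ifT.
  by apply: bump_gt0 => i; rewrite qE; exact: (svalP (hq i)).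
apply/asboolP => y /= yq; apply: eO; split => // i j; rewrite ord1 /ball/=.
have := yq j; have := svalP (hq j); rewrite qE in_itv/=.
set s := k.+1%:R^-1 in ke *; move: (ratr _) => r; rewrite ltr_norml => /andP[h1 h2] /andP[h3 h4].
by rewrite ltr_norml; apply/andP; split; lra.
Qed.

(** The N-th function joins the first N bumps, each amplified N times. Off O all bumps vanish. At a
    point x of O some F k x is positive, and once N > k the distance to 1 is at most (1 - F k x)^N,
    which tends to 0. *)
Lemma open_cutoff_approx O : open O -> exists F : nat -> 'rV[R]_d -> R,
  (forall k, cutoff O (F k)) /\ forall x, F ^~ x @ \oo --> (\1_O x : R).
Proof.
move=> /open_cutoff_cover[F [cF posF]].
exists (fun N x => 1 - \prod_(0 <= k < N) (1 - (1 - (1 - F k x) ^+ N))); split.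
  by move=> N; apply: cutoff_prod => k; exact: cutoff_expn.
move=> x; have [Ox|nOx] := pselect (O x); last first.
  rewrite indicE memNset//=; apply: cvg_near_cst; apply: nearW => N.
  rewrite big1 ?subrr// => k _.
  have [tF _] := cF k; have [A _ [AO F0]] := test_function_supp tF.
  by rewrite F0 ?subr0 ?expr1n ?subrr ?subr0// => /AO.
rewrite indicE mem_set//= -[X in _ --> X]subr0.
apply: cvgB; first exact: cvg_cst.
have [k Fk] := posF x Ox.
have F01 j : 0 <= 1 - F j x <= 1.
  by have [_ /(_ x)] := cF j => /andP[? ?]; apply/andP; split; lra.
have Fx1 : `|1 - F k x| < 1.
  by have /andP[h1 h2] := F01 k; rewrite ger0_norm//; lra.
apply: (@squeeze_cvgr _ _ _ _ (cst 0) (fun N => (1 - F k x) ^+ N)); last 2 first.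
- exact: cvg_cst.
- exact: cvg_expr Fx1.
near=> N; apply/andP; split.
  by apply: prodr_ge0 => j _; rewrite subKr exprn_ge0//; case/andP: (F01 j).
rewrite (bigD1_seq k) ?mem_index_iota ?iota_uniq//=; last by near: N; exact: nbhs_infty_gt.
rewrite subKr ler_piMr// ?exprn_ge0//; first by case/andP: (F01 k).
apply: Num.Theory.prodr_ile1 => j _; rewrite subKr; case/andP: (F01 j) => h0 h1.
by rewrite exprn_ge0//= exprn_ile1.
Unshelve. all: by end_near. Qed.

End test_functions.

(** * Sobolev spaces and the wave operator *)

Section sobolev.
Context {R : realType} {d : nat} {Om : set 'rV[R]_d} (oOm : open Om).
Hypothesis bounded_Om : bounded_set Om.
Local Notation mu := (lebesgue_on oOm).
Local Notation L2Om := (L2 (lebesgue_on oOm)).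
Local Notation dot := (@L2_dot _ _ _ (lebesgue_on oOm)).
Local Notation nm := (semi_norm (@L2_dot _ _ _ (lebesgue_on oOm))).

Let dotP : semi_dot [set: L2Om] dot := semi_dot_L2 mu.
Let dotL : bilinear_on [set: L2Om] dot := let: And3 h _ _ := dotP in h.
Let LT := lin_subspaceT mu.

Lemma L2_dotC (u v : L2Om) : dot u v = dot v u.
Proof. by case: dotP => _ h _; exact: h. Qed.

Lemma bounded_sub_cube : exists M : R, Om `<=` cube M.
Proof.
have [M [_ hM]] := bounded_Om; exists (M + 1) => x Ox i.
have := hM (M + 1) _ x Ox; rewrite ltrDl ltr01 => /(_ isT) /= xM.
rewrite in_itv/= -ler_norml (le_trans _ xM)//.
have /mapP[j Hj ->] : `|x ord0 i| \in [seq `|x y.1 y.2| | y : 'I_1 * 'I_d].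
  by apply/mapP; exists (ord0, i) => //=; rewrite mem_enum.
by rewrite [leRHS]/Num.norm /= mx_normrE; apply/bigmax_geP; right => /=; exists j.
Qed.

Lemma lebesgue_on_fin : (mu setT < +oo)%E.
Proof.
have [M OM] := bounded_sub_cube.
apply: le_lt_trans (lebesgue_row_cube d M).
rewrite /lebesgue_on /= /mrestr setTI; apply: le_measure => //; rewrite inE.
  exact: open_measurable_mx.
exact: measurable_cube.
Qed.

Lemma integral_lebesgue_on (f : 'rV[R]_d -> \bar R) :
  (forall x, ~ Om x -> f x = 0%E) ->
  (\int[mu]_x f x = \int[@lebesgue_row R d]_x f x)%E.
Proof.
move=> f0; have fE : f = f \_ Om.
  apply/funext => x; rewrite patchE; case: ifPn => // /negP xO.
  by apply: f0 => Ox; apply: xO; exact: mem_set.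
rewrite fE -[LHS]integral_mkcond -[RHS]integral_mkcond.
apply: eq_measure_integral => A mA AO /=.
by rewrite /mrestr setIidl.
Qed.

Lemma test_function_eq0 phi x : test_function Om phi -> ~ Om x -> phi x = 0.
Proof. by move=> /test_function_supp[A _ [AO h]] nO; apply: h => /AO. Qed.

Lemma test_function_Lfun phi : test_function Om phi -> phi \in Lfun mu 2%:E.
Proof.
move=> tf; have cf := class_C_continuous (test_function_smooth 0 tf).
have [A cA [AO f0]] := test_function_supp tf.
have cfA : {within A, continuous phi} by exact: continuous_subspaceT.
have [N [_ hN]] := compact_bounded (continuous_compact cfA cA).
apply: (@Lfun2_bounded _ _ _ _ lebesgue_on_fin _ (`|N| + 1)).
  exact: continuous_measurable_mx.
move=> x; have [Ax|nAx] := pselect (A x).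
  by apply: hN; [rewrite ltr_pwDr// ler_norm|exists x].
by rewrite f0// normr0 addr_ge0.
Qed.

Definition test_class phi (tf : test_function Om phi) : L2Om :=
  L2_of (test_function_Lfun tf).

Lemma integral_test_partial0 i phi : test_function Om phi ->
  \int[mu]_x partial i phi x = 0.
Proof.
move=> tf; have tp := test_function_partial i tf.
have [M OM] := bounded_sub_cube.
rewrite /Rintegral integral_lebesgue_on; last first.
  by move=> x nO; rewrite (test_function_eq0 tp).
rewrite (@integral_partial0 R d i phi M)//; first exact: (test_function_smooth 1 tf).
by move=> x xM; apply: test_function_eq0 tf _ => Ox; apply: xM; exact: OM.
Qed.

Lemma dot_test (u : L2Om) phi (tf : test_function Om phi) :
  \int[mu]_x (u x * phi x) = dot u (test_class tf).
Proof. by rewrite /test_class L2_dot_ofr. Qed.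

(** Expresses weak differentiation by scalar products of classes, so that bilinearity and
    Cauchy-Schwarz apply to it. *)
Lemma weak_partialE i (u g : L2Om) : is_weak_partial i u g <->
  forall phi (tf : test_function Om phi),
    dot u (test_class (test_function_partial i tf)) = - dot g (test_class tf).
Proof.
split=> [h phi tf|h phi tf].
  by rewrite -!dot_test; exact: h.
by rewrite (dot_test _ tf) (dot_test _ (test_function_partial i tf)); exact: h.
Qed.

(** Integration by parts: the product of two test functions is a test function, so the integral of
    its partial derivative vanishes. *)
Lemma is_weak_partial_test i phi (tf : test_function Om phi) :
  is_weak_partial i (test_class tf) (test_class (test_function_partial i tf)).
Proof.
apply/weak_partialE => psi tg.
have tp := test_function_partial i tf; have tq := test_function_partial i tg.
have fL := test_function_Lfun tf; have gL := test_function_Lfun tg.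
have pL := test_function_Lfun tp; have qL := test_function_Lfun tq.
have iq := Lfun2_mul_integrable fL qL; have ip := Lfun2_mul_integrable pL gL.
rewrite /test_class (L2_dotE fL qL (L2_ofE _) (L2_ofE _)).
rewrite (L2_dotE pL gL (L2_ofE _) (L2_ofE _)).
apply/eqP; rewrite -addr_eq0 -RintegralD//; apply/eqP.
rewrite -[RHS](@integral_test_partial0 i (fun x => phi x * psi x)); last first.
  by apply: test_functionMr => // k; exact: test_function_smooth tg.
apply: eq_Rintegral => x _.
have [_ /(_ i)[df _]] := test_function_smooth 1 tf.
have [_ /(_ i)[dg _]] := test_function_smooth 1 tg.
by rewrite [RHS](deriveM (df x) (dg x)) [partial i phi x * _]mulrC.
Qed.

Lemma test_classD phi psi (tf : test_function Om phi) (tg : test_function Om psi)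
    a chi (th : test_function Om chi) : chi =1 (fun x => a * phi x + psi x) ->
  test_class th = a *: test_class tf + test_class tg.
Proof.
move=> e; apply: L2_eqP.
apply: filterS2 (filterI (L2_ofE (test_function_Lfun tf)) (L2_ofE (test_function_Lfun tg)))
  (filterI (L2_addE (a *: test_class tf) (test_class tg)) (L2_scaleE a (test_class tf))).
by move=> x [e1 e2] [e3 e4] xT; rewrite e3// e4// e1// e2.
Qed.

Lemma test_class0 phi (tf : test_function Om phi) : phi =1 (fun=> 0) -> test_class tf = 0.
Proof.
move=> phi0; have -> : (0 : L2Om) = 0 *: test_class tf by rewrite scale0r.
apply: L2_eqP; apply: filterS (L2_scaleE 0 (test_class tf)) => x h xT.
by rewrite h// mul0r phi0.
Qed.

Lemma test_functions_dense (u : L2Om) (e : R) : 0 < e ->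
  exists phi, exists tf : test_function Om phi, nm (u - test_class tf) < e.
Proof.
pose V := [set u : L2Om | forall e : R, 0 < e ->
  exists phi, exists tf : test_function Om phi, nm (u - test_class tf) < e].
suff : V u by exact.
have nmD v w : nm (v + w) <= nm v + nm w by exact: (semi_normD LT dotP I I).
have nmZ a v : nm (a *: v) = `|a| * nm v by exact: (semi_normZ LT dotP a I).
have nm0 : nm 0 = 0 by rewrite /semi_norm (bilin0l LT dotL I) sqrtr0.
apply: (@L2_total _ _ _ _ lebesgue_on_fin (@open 'rV[R]_d)) => //.
- exact: openI.
- exact: openT.
- split.
    move=> e' e0; exists (fun=> 0), (test_function0 Om).
    by rewrite test_class0// subrr nm0.
  move=> a v w Vv Vw e' e0.
  (* The 1 allows division even when a = 0. *)
  have a0 : 0 < `|a| + 1 by rewrite ltr_pwDr.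
  have e20 : 0 < e' / 2 by rewrite divr_gt0.
  have [phi [tf hf]] := Vv _ (divr_gt0 e20 a0).
  have [psi [tg hg]] := Vw _ e20.
  exists (fun x => a * phi x + psi x), (test_functionD (test_functionZ a tf) tg).
  rewrite (test_classD tf tg (a := a))//.
  rewrite opprD addrACA -scalerBr (le_lt_trans (nmD _ _))// [ltRHS]splitr.
  rewrite ltr_leD ?ltW// nmZ; move: hf; rewrite ltr_pdivlMr// => /le_lt_trans; apply.
  by rewrite mulrC ler_wpM2l ?semi_norm_ge0// lerDl.
- move=> v Vv e' e0; have e20 : 0 < e' / 2 by rewrite divr_gt0.
  have [w Vw vw] := Vv _ e20; have [phi [tf wf]] := Vw _ e20.
  exists phi, tf; rewrite -(subrKA w) (le_lt_trans (nmD _ _))// [ltRHS]splitr.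
  by rewrite ltrD.
(* The cutoffs are built in the intersection so that they are test functions on Om. *)
- move=> O oO; have oOO : open (O `&` Om) by exact: openI.
  have m1 A : open A -> measurable_fun setT (\1_A : 'rV[R]_d -> R).
    by move=> oA; apply: measurable_indic; exact: open_measurable_mx.
  have L1 A : open A -> (\1_A : 'rV[R]_d -> R) \in Lfun mu 2%:E.
    move=> oA; apply: (@Lfun2_bounded _ _ _ _ lebesgue_on_fin _ 1); first exact: m1.
    by move=> x; rewrite indicE ger0_norm ?ler0n// lern1 leq_b1.
  have [F [cF Fcv]] := open_cutoff_approx oOO.
  have tF n : test_function Om (F n).
    by apply: test_function_subset (cF n).1 => x [].
  have c1 : (fun=> 1) \in Lfun mu 2%:E.
    by apply: (@Lfun2_bounded _ _ _ _ lebesgue_on_fin _ 1) => // x; rewrite normr1.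
  exists (L2_of (L1 _ oOO)).
    move=> e' e0.
    have mF n : measurable_fun setT (F n) by exact: Lfun2_measurable (test_function_Lfun (tF n)).
    have F1 n x : `|F n x| <= (fun=> 1) x.
      by have /andP[h0 h1] := (cF n).2 x; rewrite ger0_norm.
    have [n hn] := L2_dominated_approx c1 mF (m1 _ oOO) F1 Fcv (L2_ofE (L1 _ oOO)) e0.
    by exists (F n), (tF n); apply: hn; exact: L2_ofE.
  (* The indicators of O and of its intersection with Om differ only off Om, which is null for the
     restricted measure. *)
  apply: ae_eq_trans (L2_ofE _) _.
  exists (~` Om); split.
  + by apply: measurableC; exact: open_measurable_mx.
  + by rewrite /lebesgue_on /= /mrestr setICl measure0.
  + move=> x /= h Ox; apply: h => _.
    by rewrite !indicE in_setI (mem_set Ox) andbT.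
Qed.

Lemma dot_test_eq0 (u : L2Om) :
  (forall phi (tf : test_function Om phi), dot u (test_class tf) = 0) -> u = 0.
Proof.
move=> u0; apply: L2_dot_eq0; apply/eqP; rewrite -normr_le0.
apply/ler_addgt0Pl => e e0; rewrite addr0.
have n0 : 0 < nm u + 1 by rewrite ltr_pwDr// semi_norm_ge0.
have [phi [tf hf]] := test_functions_dense u (divr_gt0 e0 n0).
(* Orthogonality to test functions allows one to be subtracted freely; density then makes the second
   factor small. *)
have -> : dot u u = dot u (u - test_class tf) by rewrite (bilinBr LT dotL)// u0 subr0.
rewrite (le_trans (semi_CS LT dotP _ _))//.
move: hf; rewrite ltr_pdivlMr// mulrC => /ltW; apply: le_trans.
by rewrite ler_wpM2r ?semi_norm_ge0// lerDl.
Qed.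

Lemma weak_partial_unique i (u g h : L2Om) :
  is_weak_partial i u g -> is_weak_partial i u h -> g = h.
Proof.
move=> /weak_partialE ug /weak_partialE uh; apply/eqP; rewrite -subr_eq0; apply/eqP.
apply: dot_test_eq0 => phi tf; rewrite (bilinBl LT dotL)//.
by apply/eqP; rewrite subr_eq0 -eqr_opp -ug -uh.
Qed.

Lemma weak_partialP i (u : L2Om) : sobolev_H1 u -> is_weak_partial i u (weak_partial i u).
Proof.
by move=> /(_ i)[g ug]; apply: (@xgetPex _ 0 [set g | is_weak_partial i u g]); exists g.
Qed.

Lemma weak_partial_eq i (u g : L2Om) : is_weak_partial i u g -> weak_partial i u = g.
Proof.
move=> ug; apply: (@weak_partial_unique i u) => //.
by apply: (@xgetPex _ 0 [set g | is_weak_partial i u g]); exists g.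
Qed.

Lemma is_weak_partial_lin i a (u v g h : L2Om) : is_weak_partial i u g ->
  is_weak_partial i v h -> is_weak_partial i (a *: u + v) (a *: g + h).
Proof.
move=> /weak_partialE ug /weak_partialE vh; apply/weak_partialE => phi tf.
by rewrite (proj1 dotL)// (proj1 dotL)// ug vh opprD mulrN.
Qed.

Lemma is_weak_partial0 i : is_weak_partial i (0 : L2Om) 0.
Proof.
by apply/weak_partialE => phi tf; rewrite !(bilin0l LT dotL)// oppr0.
Qed.

Lemma sobolev_H1_subspace : lin_subspace (@sobolev_H1 _ _ _ oOm).
Proof.
split=> [i|a u v Hu Hv i]; first by exists 0; exact: is_weak_partial0.
have [g ug] := Hu i; have [h vh] := Hv i.
by exists (a *: g + h); exact: is_weak_partial_lin.
Qed.

Lemma weak_partial_lin i a (u v : L2Om) : sobolev_H1 u -> sobolev_H1 v ->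
  weak_partial i (a *: u + v) = a *: weak_partial i u + weak_partial i v.
Proof.
by move=> Hu Hv; apply/weak_partial_eq/is_weak_partial_lin; exact: weak_partialP.
Qed.

Lemma weak_partialB i (u v : L2Om) : sobolev_H1 u -> sobolev_H1 v ->
  weak_partial i (u - v) = weak_partial i u - weak_partial i v.
Proof.
by move=> Hu Hv; rewrite addrC -scaleN1r weak_partial_lin// scaleN1r addrC.
Qed.

Lemma weak_partial_test i phi (tf : test_function Om phi) :
  weak_partial i (test_class tf) = test_class (test_function_partial i tf).
Proof. exact/weak_partial_eq/is_weak_partial_test. Qed.

Lemma sobolev_H1_test phi (tf : test_function Om phi) : sobolev_H1 (test_class tf).
Proof.
by move=> i; exists (test_class (test_function_partial i tf)); exact: is_weak_partial_test.
Qed.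

Lemma sobolev_H2_test phi (tf : test_function Om phi) : sobolev_H2 (test_class tf).
Proof.
split; first exact: sobolev_H1_test.
by move=> i; rewrite weak_partial_test; exact: sobolev_H1_test.
Qed.

Definition H1_dist2 (u : L2Om) phi (tf : test_function Om phi) : R :=
  nm (u - test_class tf) ^+ 2 +
  \sum_i nm (weak_partial i u - test_class (test_function_partial i tf)) ^+ 2.

Lemma sobolev_H10P (u : L2Om) : sobolev_H10 u <-> sobolev_H1 u /\
  forall e : R, 0 < e -> exists phi, exists tf : test_function Om phi, H1_dist2 u tf < e.
Proof.
have key phi (tf : test_function Om phi) : H1_dist2 u tf =
    \int[mu]_x (u x - phi x) ^+ 2 +
    \sum_i \int[mu]_x (weak_partial i u x - partial i phi x) ^+ 2.
  rewrite /H1_dist2 (sqr_semi_norm dotP)// /test_class L2_dot_sqrB; congr (_ + _).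
  by apply: eq_bigr => i _; rewrite (sqr_semi_norm dotP)// L2_dot_sqrB.
split=> -[Hu h]; split=> // e /h.
  by move=> [phi tf he]; exists phi, tf; rewrite key.
by move=> [phi [tf he]]; exists phi => //; rewrite -key.
Qed.

Lemma sobolev_H10_test phi (tf : test_function Om phi) : sobolev_H10 (test_class tf).
Proof.
apply/sobolev_H10P; split=> [|e e0]; first exact: sobolev_H1_test.
have nm0 : nm 0 = 0 by rewrite /semi_norm (bilin0l LT dotL I) sqrtr0.
exists phi, tf; rewrite /H1_dist2 subrr nm0 expr0n/= add0r big1// => i _.
by rewrite weak_partial_test subrr nm0 expr0n.
Qed.

Lemma sobolev_H10_H1 (u : L2Om) : sobolev_H10 u -> sobolev_H1 u.
Proof. by case. Qed.

(** From (x + y)^2 <= 2 x^2 + 2 y^2. The squared form is wanted because [sobolev_H10] measures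
    approximation by squared distances. *)
Lemma sqr_nm_lin a (u v : L2Om) :
  nm (a *: u + v) ^+ 2 <= 2 * a ^+ 2 * nm u ^+ 2 + 2 * nm v ^+ 2.
Proof.
have := semi_normD LT dotP (I : setT (a *: u)) (I : setT v).
rewrite (semi_normZ LT dotP a (I : setT u)) => h.
rewrite -(real_normK (num_real a)).
have h0 := semi_norm_ge0 dot (a *: u + v).
move: h h0 (semi_norm_ge0 dot u) (semi_norm_ge0 dot v) (normr_ge0 a).
move: (nm _) (nm u) (nm v) `|a| => x p q r h h0 hp hq hr.
have : x ^+ 2 <= (r * p + q) ^+ 2 by rewrite lerXn2r// nnegrE addr_ge0// mulr_ge0.
by have := sqr_ge0 (r * p - q); nra.
Qed.

Lemma sobolev_H10_subspace : lin_subspace (@sobolev_H10 _ _ _ oOm).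
Proof.
split.
  by rewrite -(@test_class0 _ (test_function0 Om)); [exact: sobolev_H10_test|].
move=> a u v Hu Hv.
have Hu1 := sobolev_H10_H1 Hu; have Hv1 := sobolev_H10_H1 Hv.
move: Hu Hv => /sobolev_H10P[_ hu] /sobolev_H10P[_ hv].
apply/sobolev_H10P; split; first exact: (proj2 sobolev_H1_subspace).
(* The tolerance e / (2 a^2 + 2) balances the two coefficients in [sqr_nm_lin]. *)
move=> e e0; have A0 : 0 < 2 * a ^+ 2 + 2 by rewrite ltr_wpDl// mulr_ge0// sqr_ge0.
have e10 := divr_gt0 e0 A0.
have [phi [tf hf]] := hu _ e10; have [psi [tg hg]] := hv _ e10.
have th := test_functionD (test_functionZ a tf) tg.
exists (fun x => a * phi x + psi x), th.
apply: (@le_lt_trans _ _ (2 * a ^+ 2 * H1_dist2 u tf + 2 * H1_dist2 v tg)).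
  rewrite /H1_dist2 !mulrDr addrACA !mulr_sumr -big_split/= lerD//.
    rewrite (test_classD tf tg (a := a))// opprD addrACA -scalerBr.
    exact: sqr_nm_lin.
  apply: ler_sum => i _; rewrite weak_partial_lin//.
  rewrite (test_classD (test_function_partial i tf) (test_function_partial i tg) (a := a)).
    by rewrite opprD addrACA -scalerBr; exact: sqr_nm_lin.
  move=> x; have [_ /(_ i)[df _]] := test_function_smooth 1 tf.
  have [_ /(_ i)[dg _]] := test_function_smooth 1 tg.
  have dfa : derivable (a \*: phi) x (delta_mx ord0 i) by exact: derivableZ (df x).
  by rewrite /partial (deriveD dfa (dg x)) (deriveZ a (df x)).
have -> : e = 2 * a ^+ 2 * (e / (2 * a ^+ 2 + 2)) + 2 * (e / (2 * a ^+ 2 + 2)).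
  by rewrite -mulrDl mulrC divfK ?gt_eqF.
apply: ler_ltD; last by rewrite ltr_pM2l.
by apply: ler_wpM2l; [rewrite mulr_ge0// sqr_ge0|exact: ltW].
Qed.

(** For a test function in place of v this is the definition of the second weak derivatives, and
    both sides are continuous in v for the H^1 distance. *)
Lemma green_laplacian (u v : L2Om) : sobolev_H2 u -> sobolev_H10 v ->
  dot (laplacian u) v = - \sum_i dot (weak_partial i u) (weak_partial i v).
Proof.
move=> [Hu1 Hu2] /sobolev_H10P[Hv1 hv].
have dot_suml (F : 'I_d -> L2Om) w : dot (\sum_i F i) w = \sum_i dot (F i) w.
  elim/big_rec2: _ => [|i y z _ <-]; first exact: (bilin0l LT dotL I).
  exact: (bilinDl dotL I I I).
pose K := \sum_i nm (weak_partial i u) + nm (laplacian u) + 1.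
have S0 : 0 <= \sum_i nm (weak_partial i u) by apply: sumr_ge0 => i _; exact: semi_norm_ge0.
have K0 : 0 < K by rewrite /K ltr_pwDr// addr_ge0// semi_norm_ge0.
apply/eqP; rewrite -addr_eq0 -normr_le0; apply/ler_addgt0Pl => e e0; rewrite addr0.
have r0 : 0 < (e / K) ^+ 2 by rewrite exprn_gt0// divr_gt0.
have [phi [tf hf]] := hv _ r0.
pose w := v - test_class tf.
pose p i := weak_partial i v - test_class (test_function_partial i tf).
have small x : 0 <= x -> x ^+ 2 <= H1_dist2 v tf -> x <= e / K.
  move=> x0 xd; rewrite -(@ler_pXn2r _ 2)// ?nnegrE ?divr_ge0 ?ltW//.
  exact: le_lt_trans xd hf.
have wK : nm w <= e / K.
  apply: small; rewrite ?semi_norm_ge0// /H1_dist2 lerDl.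
  by apply: sumr_ge0 => i _; exact: sqr_ge0.
have pK i : nm (p i) <= e / K.
  apply: small; rewrite ?semi_norm_ge0// /H1_dist2 (bigD1 i)//= addrCA lerDl.
  by rewrite addr_ge0 ?sqr_ge0//; apply: sumr_ge0 => j _; exact: sqr_ge0.
(* The identity is exact for the approximating test function, so v may be replaced by the small
   remainder [w] and its derivatives by [p]. *)
have -> : dot (laplacian u) v + \sum_i dot (weak_partial i u) (weak_partial i v) =
    dot (laplacian u) w + \sum_i dot (weak_partial i u) (p i).
  rewrite /w (bilinBr LT dotL I I I).
  rewrite [in RHS](eq_bigr (fun i => dot (weak_partial i u) (weak_partial i v) -
    - dot (weak_partial i (weak_partial i u)) (test_class tf))); last first.
    move=> i _; rewrite /p (bilinBr LT dotL I I I); congr (_ - _).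
    exact: ((weak_partialE _ _ _).1 (weak_partialP i (Hu2 i))).
  by rewrite sumrB sumrN opprK /laplacian !dot_suml; ring.
rewrite (le_trans (ler_normD _ _))//.
have -> : e = nm (laplacian u) * (e / K) + (\sum_i nm (weak_partial i u)) * (e / K) + e / K.
  by rewrite -mulrDl -[X in _ + X]mul1r -mulrDl [_ + \sum_i _]addrC mulrC divfK ?gt_eqF.
apply: ler_wpDr; first by rewrite divr_ge0 ?ltW.
apply: lerD; first by rewrite (le_trans (semi_CS LT dotP I I))// ler_wpM2l// semi_norm_ge0.
rewrite (le_trans (ler_norm_sum _ _ _))// mulr_suml ler_sum// => i _.
by rewrite (le_trans (semi_CS LT dotP I I))// ler_wpM2l// semi_norm_ge0.
Qed.

End sobolev.

(* These three facts are isolated over abstract data because the same rewrites,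
   done on L^2 classes, make unification unfold L2_dot and weak_partial. *)
Lemma fst_lin (R : pzRingType) (V W : lmodType R) a (x y : V * W) :
  (a *: x + y).1 = a *: x.1 + y.1.
Proof. by []. Qed.

Lemma snd_lin (R : pzRingType) (V W : lmodType R) a (x y : V * W) :
  (a *: x + y).2 = a *: x.2 + y.2.
Proof. by []. Qed.

Lemma sumr_lin (R : pzRingType) (I : finType) (a : R) (F G : I -> R) :
  \sum_i (a * F i + G i) = a * (\sum_i F i) + \sum_i G i.
Proof. by rewrite big_split/= mulr_sumr. Qed.

(** * The wave operator on the energy space *)

Section wave.
Context {R : realType} {d : nat} {Om : set 'rV[R]_d} (oOm : open Om).
Hypothesis bounded_Om : bounded_set Om.
Local Notation mu := (lebesgue_on oOm).
Local Notation L2Om := (L2 (lebesgue_on oOm)).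
Local Notation dot := (@L2_dot _ _ _ (lebesgue_on oOm)).
Local Notation nm := (semi_norm (@L2_dot _ _ _ (lebesgue_on oOm))).

Let dotP : semi_dot [set: L2Om] dot := semi_dot_L2 mu.
Let dotL : bilinear_on [set: L2Om] dot := let: And3 h _ _ := dotP in h.
Let LT := lin_subspaceT mu.

Lemma H_space_subspace : lin_subspace (@H_space _ _ _ oOm).
Proof.
split; first exact: (proj1 (sobolev_H10_subspace oOm bounded_Om)).
move=> a U W hU hW; rewrite /H_space /mkset fst_lin.
exact: (proj2 (sobolev_H10_subspace oOm bounded_Om) a U.1 W.1 hU hW).
Qed.

Lemma H_space_H1 (U : L2Om * L2Om) : H_space U -> sobolev_H1 U.1.
Proof. exact: sobolev_H10_H1. Qed.

Lemma H_dotC (U W : L2Om * L2Om) : H_dot U W = H_dot W U.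
Proof.
have e : \sum_i dot (weak_partial i U.1) (weak_partial i W.1) =
         \sum_i dot (weak_partial i W.1) (weak_partial i U.1).
  by apply: eq_bigr => i _; exact: L2_dotC.
exact: (congr2 +%R e (L2_dotC U.2 W.2)).
Qed.

Lemma H_dot_lin a (U W Z : L2Om * L2Om) : H_space U -> H_space W ->
  H_dot (a *: U + W) Z = a * H_dot U Z + H_dot W Z.
Proof.
move=> /H_space_H1 hU /H_space_H1 hW.
have e : \sum_i dot (weak_partial i (a *: U + W).1) (weak_partial i Z.1) =
    a * (\sum_i dot (weak_partial i U.1) (weak_partial i Z.1)) +
    \sum_i dot (weak_partial i W.1) (weak_partial i Z.1).
  apply: etrans (sumr_lin _ _ _); apply: eq_bigr => i _.
  by rewrite fst_lin weak_partial_lin//; exact: (proj1 dotL).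
have e2 : dot (a *: U + W).2 Z.2 = a * dot U.2 Z.2 + dot W.2 Z.2.
  by rewrite snd_lin; exact: (proj1 dotL).
apply: etrans (congr2 +%R e e2) _.
(* Stated for arbitrary reals, so that [ring] meets no L^2 integral. *)
have dist (r x y p q : R) : r * x + y + (r * p + q) = r * (x + p) + (y + q) by ring.
exact: dist.
Qed.

Lemma semi_dot_H : semi_dot (@H_space _ _ _ oOm) (@H_dot _ _ _ oOm).
Proof.
split => //.
- split=> a U W Z hU hW hZ; first exact: H_dot_lin.
  by rewrite H_dotC H_dot_lin// (H_dotC U) (H_dotC W).
- by move=> U W _ _; exact: H_dotC.
- move=> U hU; have [_ _ ge0] := dotP; apply: addr_ge0; last exact: ge0.
  by apply: sumr_ge0 => i _; exact: ge0.
Qed.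

Lemma energy_H_dot (U : L2Om * L2Om) : energy U = 2^-1 * H_dot U U.
Proof.
rewrite /energy /H_dot -mulrDr addrC; congr (_ * (_ + _)); last first.
  by apply: eq_Rintegral => x _; rewrite real_normK ?num_real// expr2.
have int i : mu.-integrable setT (fun x => (weak_partial i U.1 x ^+ 2)%:E).
  exact: Lfun2_integrable_sqr (L2_Lfun _).
(* Integrability and the exchange of sum and integral go through one induction, since additivity of
   the integral asks for integrability of the partial sum. *)
suff [_ ->] : mu.-integrable setT (fun x => (\sum_i weak_partial i U.1 x ^+ 2)%:E) /\
    \int[mu]_x (\sum_i weak_partial i U.1 x ^+ 2) =
    \sum_i \int[mu]_x (weak_partial i U.1 x ^+ 2).
  by apply: eq_bigr => i _; apply: eq_Rintegral => x _; rewrite expr2.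
elim: (index_enum _) => [|i s [IH1 IH2]].
  under [in X in X /\ _]eq_fun do rewrite big_nil.
  split; first exact: integrable0.
  by under eq_Rintegral do rewrite big_nil; rewrite big_nil Rintegral_cst// mul0r.
under [in X in X /\ _]eq_fun do rewrite big_cons EFinD.
split; first exact: integrableD.
rewrite [RHS]big_cons -IH2 -RintegralD//; last exact: (int i).
by apply: eq_Rintegral => x _; rewrite big_cons.
Qed.

Lemma snd_le_H_norm (U : L2Om * L2Om) : nm U.2 <= H_norm U.
Proof.
rewrite /H_norm /semi_norm ler_wsqrtr// /H_dot lerDr; apply: sumr_ge0 => i _.
by have [_ _ ge0] := dotP; exact: ge0.
Qed.

Lemma wave_domain_dense (U : L2Om * L2Om) (e : R) : H_space U -> 0 < e ->
  exists2 W, wave_domain W & H_norm (U - W) < e.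
Proof.
move=> hU e0; have /(sobolev_H10P bounded_Om)[hU1 happ] : sobolev_H10 U.1 by exact: hU.
have e20 : 0 < e / 2 by rewrite divr_gt0.
have [phi [tf hf]] := happ _ (exprn_gt0 2 e20).
have [psi [tg hg]] := test_functions_dense bounded_Om U.2 e20.
pose u := test_class oOm bounded_Om tf; pose v := test_class oOm bounded_Om tg.
have dW : wave_domain (u, v).
  by split; [exact: sobolev_H2_test|exact: sobolev_H10_test|exact: sobolev_H10_test].
exists (u, v); first exact: dW.
have le1 : \sum_i dot (weak_partial i (U.1 - u)) (weak_partial i (U.1 - u)) <=
    H1_dist2 bounded_Om U.1 tf.
  apply: ler_wpDl; first exact: sqr_ge0.
  apply: ler_sum => i _; rewrite weak_partialB//; last exact: sobolev_H1_test.
  by rewrite weak_partial_test (sqr_semi_norm dotP).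
have lt2 : dot (U.2 - v) (U.2 - v) < (e / 2) ^+ 2.
  by rewrite -(sqr_semi_norm dotP)// ltr_pXn2r// nnegrE ?semi_norm_ge0// ltW.
have lt3 := ltrD (le_lt_trans le1 hf) lt2.
(* Each component contributes at most a quarter of e^2 to the squared norm. *)
have lt4 : (e / 2) ^+ 2 + (e / 2) ^+ 2 < e ^+ 2.
  by rewrite exprMn; have := exprn_gt0 2 e0; lra.
have sqrt_lt (x : R) : x < e ^+ 2 -> Num.sqrt x < e.
  by move=> xe; rewrite -[ltRHS]gtr0_norm// -sqrtr_sqr ltr_sqrt// exprn_gt0.
exact: sqrt_lt _ (lt_trans lt3 lt4).
Qed.

Lemma wave_operator_dissipation (P : {linear L2Om -> L2Om}) (U : L2Om * L2Om) :
  wave_domain U -> H_dot (- wave_operator P U) U = - dot (P U.2) U.2.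
Proof.
move=> [H2 H10 H10v]; rewrite /H_dot /wave_operator /=.
(* With U = (u, v), the negated operator has components v and laplacian u - P v; what Green's
   formula gives cancels the first sum up to symmetry. *)
rewrite opprD !opprK (bilinBl LT dotL I I I) (green_laplacian bounded_Om H2 H10v).
rewrite addrA [X in X + _](_ : _ = 0) ?add0r//.
by apply/eqP; rewrite subr_eq0; apply/eqP/eq_bigr => i _; rewrite L2_dotC.
Qed.

End wave.

Theorem theorem2p6 (R : realType) (d : nat) (d_ge1 : (1 <= d)%N)
    (Om : set 'rV[R]_d) (oOm : open Om)
    (bounded_Om : bounded_set Om) (connected_Om : connected Om)
    (C2_Om : C2_boundary Om)
    (P : {linear L2 (lebesgue_on oOm) -> L2 (lebesgue_on oOm)})
    (bounded_P : bounded_operator P) (monotone_P : monotone_operator P)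
    (S : R -> L2 (lebesgue_on oOm) * L2 (lebesgue_on oOm) ->
      L2 (lebesgue_on oOm) * L2 (lebesgue_on oOm))
    (semigroup_S : contraction_semigroup S)
    (generator_S : infinitesimal_generator S (wave_domain (oOm := oOm))
      (fun U => - wave_operator P U))
    (U0 : L2 (lebesgue_on oOm) * L2 (lebesgue_on oOm)) (HU0 : H_space U0) :
  (forall t : R, 0 <= t ->
    lebesgue_measure.-integrable `[0, t]
      (fun s => (L2_dot (P (S s U0).2) (S s U0).2)%:E) /\
    energy (S t U0) +
      \int[lebesgue_measure]_(s in `[0, t]) L2_dot (P (S s U0).2) (S s U0).2
    = energy U0) /\
  (forall s t : R, 0 <= s -> s <= t -> energy (S t U0) <= energy (S s U0)).
Proof.
have [S_H S_lin S_contr S0 SD S_cont] := semigroup_S.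
have Hs := H_space_subspace oOm bounded_Om; have Hd := semi_dot_H oOm bounded_Om.
have [L2l _ _] := semi_dot_L2 (lebesgue_on oOm).
have LT := lin_subspaceT (lebesgue_on oOm).
have [C hC] := bounded_P.
pose b (U W : L2 (lebesgue_on oOm) * L2 (lebesgue_on oOm)) := L2_dot (P U.2) W.2.
have b_lin : bilinear_on (@H_space _ _ _ oOm) b.
  split=> a U W Z _ _ _; rewrite /b /=; last exact: (proj2 L2l).
  by rewrite linearP (proj1 L2l).
(* The absolute value enters because the bound [C] for [P] carries no sign. *)
have bC U W : H_space U -> H_space W -> `|b U W| <= `|C| * (H_norm U * H_norm W).
  move=> _ _; rewrite (le_trans (semi_CS LT (semi_dot_L2 _) I I))// mulrA.
  rewrite ler_pM ?semi_norm_ge0//; last exact: snd_le_H_norm.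
  rewrite -L2_norm_semi (le_trans (hC _))// (@le_trans _ _ (`|C| * L2_norm U.2))//.
    by rewrite ler_wpM2r ?sqrtr_ge0// ler_norm.
  by rewrite ler_wpM2l// snd_le_H_norm.
have DH : @wave_domain _ _ _ oOm `<=` @H_space _ _ _ oOm by move=> U [_ h _]; exact: h.
have GH U : wave_domain U -> H_space (- wave_operator P U).
  by case=> _ _ h; rewrite /H_space /mkset /wave_operator /= opprK; exact: h.
split=> [t t0|s t s0 st].
  split.
    exact: (quad_curve_integrable Hs Hd S_H S_lin S_contr S0 SD S_cont b_lin
      (normr_ge0 C) bC t HU0).
  have := semigroup_energy_balance Hs Hd S_H S_lin S_contr S0 SD S_cont DH GH
    generator_S b_lin (normr_ge0 C) bC
    (wave_operator_dissipation bounded_Om P) (wave_domain_dense bounded_Om) HU0 t0.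
  (* The abstract balance concerns the squared norm, which is twice the energy. *)
  have half (x y z : R) : x + 2 * y = z -> 2^-1 * x + y = 2^-1 * z by lra.
  by rewrite !energy_H_dot => /half.
(* The decay of energy is read off from contraction: the state at time t is the state at time s
   moved by [S (t - s)]. *)
have st0 : 0 <= t - s by rewrite subr_ge0.
have hs := S_H _ _ s0 HU0.
rewrite !energy_H_dot ler_wpM2l// -(subrK s t) (SD _ _ _ st0 s0 HU0).
have := S_contr _ _ st0 hs; rewrite /H_norm ler_sqrt//.
by have [_ _ ge0] := Hd; exact: ge0.
Qed.
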